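(* Let $(G,G_0,G_{\mathrm f})$ be a condensing IMG group triplet with hyperfinite abelian ambient group $G$, $d$ a normalizing multiplier for it, and $\mathbf G=G_{\mathrm f}/G_0$. Let the internal function $g\in\mathcal M(G,G_0,G_{\mathrm f})$ be a weak lifting of a complex regular Borel measure $\boldsymbol\mu\in M(\mathbf G)$. Then the internal function $\widehat g$, the internal discrete Fourier transform of $g$, belongs to $\mathcal C_{\mathrm{bu}}(\widehat G,G_{\mathrm f}^{\sim})$ and is a lifting of the Fourier–Stieltjes transform $\widehat{\boldsymbol\mu}\in C_{\mathrm{bu}}(\widehat{\mathbf G})$, i.e. $\widehat{\boldsymbol\mu}(\gamma^\flat)={}^\circ\widehat g(\gamma)$ for all $\gamma\in G_0^{\sim}$.
   Context: Nonstandard setting: one works in a $\kappa$-saturated nonstandard universe (elementary extension $X\mapsto{}^*X$ of a superstructure), $\kappa$ uncountable. ''Admissible size'' means external cardinality $<\kappa$. A monadic set is the intersection, and a galactic set the union, of a family of admissible size of internal sets. A hyperfinite set is an internal set in internal bijection with $\{1,\dots,n\}$ for some $n\in{}^*\mathbb N$; $|A|=n$ is its internal number of elements. For hypercomplex numbers, $a\approx b$ means that $a-b$ is infinitesimal, $a<\infty$ means that $a\ge0$ is finite, and ${}^\circ a$ is the standard part. $\mathbb T$ is the multiplicative group of complex numbers of modulus 1. Triplets: an IMG group triplet with hyperfinite abelian ambient group is $(G,G_0,G_{\mathrm f})$, where $G$ is an internal hyperfinite abelian group (additive), $G_0\subseteq G_{\mathrm f}$ are subgroups of $G$, $G_0$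 is monadic and $G_{\mathrm f}$ is galactic. It is condensing if $|A|/|B|$ is finite and noninfinitesimal for any internal sets $A,B$ with $G_0\subseteq A,B\subseteq G_{\mathrm f}$. A normalizing multiplier is a positive $d\in{}^*\mathbb R$ such that $d|A|$ is finite and noninfinitesimal for some (equivalently each) internal $A$ with $G_0\subseteq A\subseteq G_{\mathrm f}$. The observable trace $\mathbf G=G_{\mathrm f}/G_0$, $x^\flat=x+G_0$, is topologized so that $Y\subseteq\mathbf G$ is open iff for each $x\in G_{\mathrm f}$ with $x^\flat\in Y$ there is an internal $A$ with $x+G_0\subseteq A\subseteq\{y\in G_{\mathrm f}:y^\flat\in Y\}$; it is a Hausdorff LCA group. Dual: $\widehat G$ is the group of internal homomorphisms $G\to{}^*\mathbb T$; for $A\subseteq G$, $A^{\sim}=\{\gamma\in\widehat G:\gamma(a)\approx1\ \forall a\in A\}$. $(\widehat G,G_{\mathrm f}^{\sim},G_0^{\sim})$ is again a condensing IMG group triplet. Its observable trace $G_0^{\sim}/G_{\mathrm f}^{\sim}$ is identified with the dual group $\widehat{\mathbf G}$ via the topological isomorphism $\gamma G_{\mathrm f}^{\sim}\mapsto\gamma^\flat$, $\gamma^\flat(x^\flat)={}^\circ\gamma(x)$. Function spaces: put $\|g\|_1=d\sum_{x\in G}|g(x)|$. $\mathcal M(G,G_0,G_{\mathrm f})$ is the set of internal $g:G\to{}^*\mathbb C$ with $\|g\|_1<\infty$ and $\|g\cdot1_Z\|_1\approx0$ for each internal $Z\subseteq G\smallsetminus G_{\mathrm f}$. $\mathcal C_0(G,G_0,G_{\mathrm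 f})$ is the set of internal $f:G\to{}^*\mathbb C$ with $\max_x|f(x)|<\infty$, $f(x)\approx f(y)$ whenever $x,y\in G_{\mathrm f}$ and $x-y\in G_0$, and $f(x)\approx0$ for $x\in G\smallsetminus G_{\mathrm f}$; for such $f$, $f^\flat:\mathbf G\to\mathbb C$ is given by $f^\flat(x^\flat)={}^\circ f(x)$ and is continuous vanishing at infinity. $M(\mathbf G)$ is the space of complex regular Borel measures of finite total variation on $\mathbf G$. An internal $g:G\to{}^*\mathbb C$ is a weak lifting of $\boldsymbol\mu\in M(\mathbf G)$ if $\int f^\flat\,d\boldsymbol\mu={}^\circ\bigl(d\sum_{x\in G}f(x)g(x)\bigr)$ for every $f\in\mathcal C_0(G,G_0,G_{\mathrm f})$. $\mathcal C_{\mathrm{bu}}(\widehat G,G_{\mathrm f}^{\sim})$ is the set of internal $h:\widehat G\to{}^*\mathbb C$ with $\max_\gamma|h(\gamma)|<\infty$ and $h(\gamma)\approx h(\chi)$ for all $\gamma,\chi\in\widehat G$ with $\gamma\chi^{-1}\in G_{\mathrm f}^{\sim}$. $C_{\mathrm{bu}}(\widehat{\mathbf G})$ is the space of bounded uniformly continuous functions $\widehat{\mathbf G}\to\mathbb C$. Fourier transforms: $\widehat g(\gamma)=d\sum_{x\in G}g(x)\overline{\gamma(x)}$ for $\gamma\in\widehat G$; $\widehat{\boldsymbol\mu}(\boldsymbol\gamma)=\int\overline{\boldsymbol\gamma}\,d\boldsymbol\mu$ for $\boldsymbol\gamma\in\widehat{\mathbf G}$. *)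

(* Defs.v *)
From HB Require Import structures.
From mathcomp Require Import all_boot all_order all_algebra.
From mathcomp Require Import all_classical all_reals all_analysis.
From mathcomp Require Import complex.

Set Implicit Arguments.
Unset Strict Implicit.
Unset Printing Implicit Defensive.

Import Order.TTheory GRing.Theory Num.Theory.
Import numFieldNormedType.Exports.
Local Open Scope classical_set_scope.
Local Open Scope card_scope.
Local Open Scope ring_scope.

(* The superstructure over a set [X] of individuals is presented in typed form:
   its levels are the types obtained from [X], nat, [R] and [R[i]] by products,
   function spaces and power sets. *)
Inductive styp : Type :=
  | tInd | tNat | tReal | tCplx
  | tProd of styp & styp | tFun of styp & styp | tPow of styp.

Fixpoint interp (X : Type) (R : realType) (t : styp) : Type :=
  match t with
  | tInd => X
  | tNat => nat
  | tReal => R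
  | tCplx => R[i]
  | tProd s t => (interp X R s * interp X R t)%type
  | tFun s t => interp X R s -> interp X R t
  | tPow s => set (interp X R s)
  end.

(* First-order language of the superstructure: equality, membership, pairing,
   application, and a constant for every standard object.  A variable of
   [var Gam t] is a de Bruijn index into [Gam] pointing to an entry [t]. *)
Inductive var : seq styp -> styp -> Type :=
  | var0 Gam t : var (t :: Gam) t
  | varS Gam t u : var Gam t -> var (u :: Gam) t.

Inductive term (X : Type) (R : realType) (Gam : seq styp) : styp -> Type :=
  | TVar t : var Gam t -> term X R Gam t
  | TCst t : interp X R t -> term X R Gam t
  | TApp s t : term X R Gam (tFun s t) -> term X R Gam s -> term X R Gam t
  | TPair s t : term X R Gam s -> term X R Gam t -> term X R Gam (tProd s t).

Inductive form (X : Type) (R : realType) : seq styp -> Type :=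
  | FEq Gam t : term X R Gam t -> term X R Gam t -> form X R Gam
  | FMem Gam t : term X R Gam t -> term X R Gam (tPow t) -> form X R Gam
  | FBot Gam : form X R Gam
  | FImp Gam : form X R Gam -> form X R Gam -> form X R Gam
  | FAll Gam t : form X R (t :: Gam) -> form X R Gam.

Record model (X : Type) (R : realType) : Type := Model {
  idom :> styp -> Type;
  icst : forall t, interp X R t -> idom t;
  iapp : forall s t, idom (tFun s t) -> idom s -> idom t;
  ipair : forall s t, idom s -> idom t -> idom (tProd s t);
  imem : forall t, idom t -> idom (tPow t) -> Prop }.

Fixpoint env (D : styp -> Type) (Gam : seq styp) : Type :=
  if Gam is t :: Gam' then (D t * env D Gam')%type else unit.

Fixpoint lookup (D : styp -> Type) Gam t (v : var Gam t) : env D Gam -> D t :=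
  match v in var Gam t return env D Gam -> D t with
  | var0 _ _ => fun e => e.1
  | varS _ _ _ v' => fun e => lookup v' e.2
  end.

Section Semantics.
Variables (X : Type) (R : realType) (M : model X R).

Fixpoint teval Gam t (a : term X R Gam t) (e : env M Gam) : M t :=
  match a in term _ _ _ t return M t with
  | TVar _ v => lookup v e
  | TCst _ c => icst M c
  | TApp _ _ f b => iapp (teval f e) (teval b e)
  | TPair _ _ b c => ipair (teval b e) (teval c e)
  end.

Fixpoint sat Gam (phi : form X R Gam) : env M Gam -> Prop :=
  match phi in form _ _ Gam return env M Gam -> Prop with
  | FEq _ _ a b => fun e => teval a e = teval b e
  | FMem _ _ a A => fun e => imem (teval a e) (teval A e)
  | FBot _ => fun _ => False
  | FImp _ p q => fun e => sat p e -> sat q e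
  | FAll _ t p => fun e => forall x : M t, sat p (x, e)
  end.

End Semantics.

Definition standard_model (X : Type) (R : realType) : model X R :=
  @Model X R (interp X R) (fun t c => c) (fun s t f x => f x)
    (fun s t x y => (x, y)) (fun t x A => A x).

(* The cardinal kappa is that of the type [K]. *)
Definition admissible (K T : Type) (F : set T) : Prop :=
  F #<= [set: K] /\ ~ ([set: K] #<= F).

Record nonstandard_universe (K X : Type) (R : realType) : Type := {
  universe :> model X R;
  transfer : forall phi : form X R [::],
    @sat X R (standard_model X R) _ phi tt <-> @sat X R universe _ phi tt;
  saturation : forall t (F : set (universe (tPow t))),
    admissible K F ->
    (forall D : set (universe (tPow t)), D `<=` F -> finite_set D ->
       exists x, forall A, D A -> imem x A) ->
    exists x, forall A, F A -> imem x A }.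

Section Lifts.
Variables (K X : Type) (R : realType) (U : nonstandard_universe K X R).
Local Notation I := (interp X R).

Definition lift1 s t (f : I s -> I t) (x : U s) : U t :=
  iapp (icst U (t := tFun s t) f) x.

Definition lift2 s t u (f : I s -> I t -> I u) (x : U s) (y : U t) : U u :=
  iapp (iapp (icst U (t := tFun s (tFun t u)) f) x) y.

Definition lift3 s t u v (f : I s -> I t -> I u -> I v)
    (x : U s) (y : U t) (z : U u) : U v :=
  iapp (iapp (iapp (icst U (t := tFun s (tFun t (tFun u v))) f) x) y) z.

Definition lift_rel s t (P : I s -> I t -> Prop) (x : U s) (y : U t) : Prop :=
  imem y (iapp (icst U (t := tFun s (tPow t)) P) x).

Definition hreal (r : R) : U tReal := icst U (t := tReal) r.
Definition hcplx (z : R[i]) : U tCplx := icst U (t := tCplx) z.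

Definition hnat_le : U tNat -> U tNat -> Prop :=
  @lift_rel tNat tNat (fun m n => (m <= n)%N).
Definition hnat_real : U tNat -> U tReal := @lift1 tNat tReal (fun n => n%:R).

Definition hle : U tReal -> U tReal -> Prop :=
  @lift_rel tReal tReal (fun a b => a <= b).
Definition hlt : U tReal -> U tReal -> Prop :=
  @lift_rel tReal tReal (fun a b => a < b).
Definition hmulr : U tReal -> U tReal -> U tReal :=
  @lift2 tReal tReal tReal (fun a b => a * b).
Definition hdivr : U tReal -> U tReal -> U tReal :=
  @lift2 tReal tReal tReal (fun a b => a / b).
Definition habsr : U tReal -> U tReal := @lift1 tReal tReal (fun a => `|a|).

Definition hsubc : U tCplx -> U tCplx -> U tCplx :=
  @lift2 tCplx tCplx tCplx (fun a b => a - b).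
Definition hmulc : U tCplx -> U tCplx -> U tCplx :=
  @lift2 tCplx tCplx tCplx (fun a b => a * b).
Definition hnormc : U tCplx -> U tReal :=
  @lift1 tCplx tReal (fun a => Normc.normc a).

Definition finite_r (a : U tReal) : Prop := exists r : R, hle (habsr a) (hreal r).
Definition infinitesimal_r (a : U tReal) : Prop :=
  forall e : R, 0 < e -> hlt (habsr a) (hreal e).
Definition lt_infty (a : U tReal) : Prop := hle (hreal 0) a /\ finite_r a.

Definition finite_c (z : U tCplx) : Prop := finite_r (hnormc z).
Definition approx (a b : U tCplx) : Prop := infinitesimal_r (hnormc (hsubc a b)).

(* meaningful for finite [z] only; 0 otherwise *)
Definition stpart (z : U tCplx) : R[i] := xget 0 [set c | approx z (hcplx c)].

Definition internal_card t (A : U (tPow t)) (n : U tNat) : Prop :=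
  exists f : U (tFun tNat t),
    set_bij [set k | hnat_le (icst U (t := tNat) 1%N) k /\ hnat_le k n]
            [set x | imem x A] (iapp f).

(* The internal operations are given on the whole of [U t]; only their values
   on the carrier matter. *)
Record hyperfinite_abelian_group (t : styp) : Type := {
  carrier : U (tPow t);
  gadd : U (tFun t (tFun t t));
  gzero : U t;
  gopp : U (tFun t t);
  gadd_closed : forall x y, imem x carrier -> imem y carrier ->
    imem (iapp (iapp gadd x) y) carrier;
  gzero_closed : imem gzero carrier;
  gopp_closed : forall x, imem x carrier -> imem (iapp gopp x) carrier;
  gaddA : forall x y z, imem x carrier -> imem y carrier -> imem z carrier ->
    iapp (iapp gadd x) (iapp (iapp gadd y) z) = iapp (iapp gadd (iapp (iapp gadd x) y)) z;
  gaddC : forall x y, imem x carrier -> imem y carrier ->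
    iapp (iapp gadd x) y = iapp (iapp gadd y) x;
  gadd0 : forall x, imem x carrier -> iapp (iapp gadd gzero) x = x;
  gaddN : forall x, imem x carrier -> iapp (iapp gadd (iapp gopp x)) x = gzero;
  ghyperfinite : exists n, internal_card carrier n }.

End Lifts.

Arguments hreal {K X R} U r.
Arguments hcplx {K X R} U z.

Section Group.
Variables (K X : Type) (R : realType) (U : nonstandard_universe K X R).
Variables (t : styp) (G : hyperfinite_abelian_group U t).

Record gelt : Type := GElt { gval :> U t; gvalP : imem gval (carrier G) }.

Lemma gval_inj : injective gval.
Proof.
move=> [x xG] [y yG] /= exy; move: xG yG; rewrite exy => xG yG.
by rewrite (Prop_irrelevance xG yG).
Qed.

HB.instance Definition _ := gen_eqMixin gelt.
HB.instance Definition _ := gen_choiceMixin gelt.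

Definition gelt_add (x y : gelt) : gelt :=
  GElt (gadd_closed (gvalP x) (gvalP y)).
Definition gelt_zero : gelt := GElt (gzero_closed G).
Definition gelt_opp (x : gelt) : gelt := GElt (gopp_closed (gvalP x)).

Lemma gelt_addA : associative gelt_add.
Proof. by move=> x y z; apply: gval_inj; apply: gaddA; exact: gvalP. Qed.
Lemma gelt_addC : commutative gelt_add.
Proof. by move=> x y; apply: gval_inj; apply: gaddC; exact: gvalP. Qed.
Lemma gelt_add0 : left_id gelt_zero gelt_add.
Proof. by move=> x; apply: gval_inj; apply: gadd0; exact: gvalP. Qed.
Lemma gelt_addN : left_inverse gelt_zero gelt_opp gelt_add.
Proof. by move=> x; apply: gval_inj; apply: gaddN; exact: gvalP. Qed.

HB.instance Definition _ :=
  GRing.isZmodule.Build gelt gelt_addA gelt_addC gelt_add0 gelt_addN.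

Definition internal_subset (A : U (tPow t)) : Prop :=
  forall x, imem x A -> imem x (carrier G).

Definition ext (A : U (tPow t)) : set gelt := [set x | imem (gval x) A].

Definition subgroup (S : set gelt) : Prop :=
  S 0 /\ forall x y, S x -> S y -> S (x - y).

Definition monadic (S : set gelt) : Prop :=
  exists F : set (U (tPow t)), admissible K F /\ S = \bigcap_(A in F) ext A.

Definition galactic (S : set gelt) : Prop :=
  exists F : set (U (tPow t)), admissible K F /\ S = \bigcup_(A in F) ext A.

Record triplet : Type := Triplet {
  G0 : set gelt;
  Gf : set gelt;
  G0_subgroup : subgroup G0;
  Gf_subgroup : subgroup Gf;
  G0_sub_Gf : G0 `<=` Gf;
  G0_monadic : monadic G0;
  Gf_galactic : galactic Gf }.

End Group.

Section Matching.
Variables (T S : Type) (A : set T) (B : set S).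

Let partial_injection (r : set (T * S)) :=
  [/\ r `<=` [set p | A p.1 /\ B p.2],
      forall x y z, r (x, y) -> r (x, z) -> y = z &
      forall x y z, r (x, z) -> r (y, z) -> x = y].

(* comparability of cardinals, in relational form *)
Lemma matching : exists r : set (T * S),
  [/\ forall x y, r (x, y) -> A x /\ B y,
      forall x y z, r (x, y) -> r (x, z) -> y = z,
      forall x y z, r (x, z) -> r (y, z) -> x = y &
      (forall x, A x -> exists y, r (x, y)) \/
      (forall y, B y -> exists x, r (x, y))].
Proof.
have [F FP Ftot|r [[rAB rfun rinj] rmax]] := @Zorn_bigcup _ partial_injection.
  have common p q : (\bigcup_(Y in F) Y) p -> (\bigcup_(Y in F) Y) q ->
      exists2 Y, F Y & Y p /\ Y q.
    move=> [Y FY Yp] [Z FZ Zq]; have [YZ|ZY] := Ftot _ _ FY FZ.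
      by exists Z => //; split=> //; exact: YZ.
    by exists Y => //; split=> //; exact: ZY.
  split.
  - by move=> p [Y FY Yp]; have [YAB _ _] := FP _ FY; exact: YAB.
  - move=> x y z xy xz; have [Y FY [Yxy Yxz]] := common _ _ xy xz.
    by have [_ Yf _] := FP _ FY; exact: Yf Yxy Yxz.
  - move=> x y z xy xz; have [Y FY [Yxy Yxz]] := common _ _ xy xz.
    by have [_ _ Yi] := FP _ FY; exact: Yi Yxy Yxz.
exists r; split=> // [x y /rAB //|].
apply: contrapT => /not_orP[/existsNP[a /not_implyP[Aa ra]]].
move=> /existsNP[b /not_implyP[Bb rb]].
have nrab : ~ r (a, b) by move=> rab; apply: ra; exists b.
apply: (rmax (r `|` [set (a, b)])).
  by split=> [p ?|/(_ (a, b))]; [left|move=> h; apply: nrab; apply: h; right].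
split.
- by move=> p [/rAB //|->].
- move=> x y z [xy|[-> ->]] [xz|].
  + exact: rfun xy xz.
  + by move=> [xa _]; case: ra; exists y; rewrite -xa.
  + by case: ra; exists z.
  + by case.
- move=> x y z [xz|[-> ->]] [yz|].
  + exact: rinj xz yz.
  + by move=> [_ zb]; case: rb; exists x; rewrite -zb.
  + by case: rb; exists y.
  + by case.
Qed.

End Matching.

Section InternalSets.
Variables (K X : Type) (R : realType) (U : nonstandard_universe K X R).
Variable t : styp.
Implicit Types A B : U (tPow t).

Lemma admissible_image (T S : Type) (f : T -> S) (F : set T) :
  admissible K F -> admissible K (f @` F).
Proof.
move=> [FK KF]; have fF := card_image_le f F; split.
  exact: card_le_trans fF FK.
by move=> KfF; apply: KF; exact: card_le_trans KfF fF.
Qed.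

Definition iset0 : U (tPow t) := icst U (t := tPow t) set0.
Definition isetU : U (tPow t) -> U (tPow t) -> U (tPow t) :=
  @lift2 _ _ _ U (tPow t) (tPow t) (tPow t) setU.
Definition isetI : U (tPow t) -> U (tPow t) -> U (tPow t) :=
  @lift2 _ _ _ U (tPow t) (tPow t) (tPow t) setI.
Definition isetD : U (tPow t) -> U (tPow t) -> U (tPow t) :=
  @lift2 _ _ _ U (tPow t) (tPow t) (tPow t) setD.

Definition FNot (Gam : seq styp) (p : form X R Gam) := FImp p (FBot X R Gam).
Definition FAnd (Gam : seq styp) (p q : form X R Gam) :=
  FNot (FImp p (FNot q)).
Definition FIff (Gam : seq styp) (p q : form X R Gam) :=
  FAnd (FImp p q) (FImp q p).

Lemma sat_not (M : model X R) (Gam : seq styp) (p : form X R Gam)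
    (e : env M Gam) : sat (FNot p) e = ~ sat p e.
Proof. by []. Qed.

Lemma sat_and (M : model X R) (Gam : seq styp) (p q : form X R Gam)
    (e : env M Gam) : sat (FAnd p q) e <-> sat p e /\ sat q e.
Proof.
split=> /= [h|[hp hq] h]; last exact: h.
by split; apply: contrapT => n; apply: h => *; apply: n.
Qed.

Lemma sat_iff (M : model X R) (Gam : seq styp) (p q : form X R Gam)
    (e : env M Gam) : sat (FIff p q) e <-> (sat p e <-> sat q e).
Proof. by rewrite /FIff sat_and; split=> -[]. Qed.

Lemma transfer_open (Gam : seq styp) (q : form X R Gam) :
  (forall e : env (standard_model X R) Gam, sat q e) ->
  forall e : env U Gam, sat q e.
Proof.
elim: Gam q => [|s Gam IH] q h; first by case; apply/transfer/h.
by move=> [x e]; apply: (IH (FAll q)) => e' y; exact: h.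
Qed.

Let Gam3 := [:: t; tPow t; tPow t].
Let x3 : term X R Gam3 t := TVar X R (var0 _ _).
Let B3 : term X R Gam3 (tPow t) := TVar X R (varS _ (var0 _ _)).
Let A3 : term X R Gam3 (tPow t) := TVar X R (varS _ (varS _ (var0 _ _))).
Let op3 (f : set (interp X R t) -> set (interp X R t) -> set (interp X R t)) :=
  TApp (TApp (TCst (t := tFun (tPow t) (tFun (tPow t) (tPow t))) Gam3 f) A3) B3.

Lemma imem_set0 (x : U t) : ~ imem x iset0.
Proof.
apply: (@transfer_open [:: t] (FImp (FMem (TVar X R (var0 _ _))
  (TCst (t := tPow t) _ set0)) (FBot _ _ _)) _ (x, tt)).
by move=> e /=.
Qed.

Lemma imem_setI A B (x : U t) : imem x (isetI A B) <-> imem x A /\ imem x B.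
Proof.
pose q := FIff (FMem x3 (op3 setI)) (FAnd (FMem x3 A3) (FMem x3 B3)).
have /(_ (x, (B, (A, tt)))) : forall e : env U Gam3, sat q e.
  by apply: transfer_open => e; rewrite sat_iff sat_and.
by rewrite sat_iff sat_and.
Qed.

Lemma imem_setD A B (x : U t) : imem x (isetD A B) <-> imem x A /\ ~ imem x B.
Proof.
pose q := FIff (FMem x3 (op3 setD)) (FAnd (FMem x3 A3) (FNot (FMem x3 B3))).
have /(_ (x, (B, (A, tt)))) : forall e : env U Gam3, sat q e.
  by apply: transfer_open => e; rewrite sat_iff sat_and.
by rewrite sat_iff sat_and.
Qed.

Lemma imem_setU A B (x : U t) : imem x (isetU A B) <-> imem x A \/ imem x B.
Proof.
pose q := FIff (FMem x3 (op3 setU))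
  (FNot (FAnd (FNot (FMem x3 A3)) (FNot (FMem x3 B3)))).
have deMorgan (P Q : Prop) : ~ (~ P /\ ~ Q) <-> P \/ Q.
  by split=> [h|[p|p] []//]; apply: contrapT => /not_orP.
have /(_ (x, (B, (A, tt)))) : forall e : env U Gam3, sat q e.
  by apply: transfer_open => e; rewrite sat_iff sat_not sat_and !sat_not deMorgan.
by rewrite sat_iff sat_not sat_and !sat_not deMorgan.
Qed.

(* {y | y - a \in A} for the internal operations [add] and [opp] *)
Definition itranslate (add : U (tFun t (tFun t t))) (opp : U (tFun t t))
    (a : U t) A : U (tPow t) :=
  iapp (@lift3 _ _ _ U (tFun t (tFun t t)) (tFun t t) t (tFun (tPow t) (tPow t))
    (fun add opp a Y => [set y | Y (add y (opp a))]) add opp a) A.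

Lemma imem_translate add opp a A (y : U t) :
  imem y (itranslate add opp a A) <-> imem (iapp (iapp add y) (iapp opp a)) A.
Proof.
pose Gam := [:: t; tPow t; t; tFun t t; tFun t (tFun t t)].
pose y' : var Gam t := var0 _ _.
pose A' : var Gam (tPow t) := varS _ (var0 _ _).
pose a' : var Gam t := varS _ (varS _ (var0 _ _)).
pose opp' : var Gam (tFun t t) := varS _ (varS _ (varS _ (var0 _ _))).
pose add' : var Gam (tFun t (tFun t t)) :=
  varS _ (varS _ (varS _ (varS _ (var0 _ _)))).
pose c := TCst (t := tFun (tFun t (tFun t t)) (tFun (tFun t t)
  (tFun t (tFun (tPow t) (tPow t))))) Gam
  (fun add opp a Y => [set y : interp X R t | Y (add y (opp a))]).
pose V s (v : var Gam s) := TVar X R v.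
pose q := FIff
  (FMem (V _ y') (TApp (TApp (TApp (TApp c (V _ add')) (V _ opp')) (V _ a')) (V _ A')))
  (FMem (TApp (TApp (V _ add') (V _ y')) (TApp (V _ opp') (V _ a'))) (V _ A')).
have /(_ (y, (A, (a, (opp, (add, tt)))))) : forall e : env U Gam, sat q e.
  by apply: transfer_open => e; rewrite sat_iff.
by rewrite sat_iff.
Qed.

Lemma finite_union_internal (F : set (U (tPow t))) : finite_set F ->
  exists B, forall x, imem x B <-> exists2 A, F A & imem x A.
Proof.
move=> /(@finite_seqP {classic (U (tPow t))})[s ->].
elim: s => [|A s [B BP]].
  by exists iset0 => x; split=> [/imem_set0//|[]].
exists (isetU A B) => x; rewrite imem_setU BP; split.
  move=> [xA|[C Cs xC]]; first by exists A => //=; rewrite mem_head.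
  by exists C => //=; rewrite inE; apply/orP; right.
move=> [C /=]; rewrite inE => /orP[/eqP -> ?|Cs xC]; first by left.
by right; exists C.
Qed.

(* saturation for the union of two admissible families *)
Lemma saturationU (F1 F2 : set (U (tPow t))) :
  admissible K F1 -> admissible K F2 ->
  (forall D, D `<=` F1 `|` F2 -> finite_set D ->
     exists x : U t, forall A, D A -> imem x A) ->
  exists x : U t, forall A, (F1 `|` F2) A -> imem x A.
Proof.
have half (r : U (tPow t) -> U (tPow t) -> Prop) (E1 E2 : set (U (tPow t))) :
    admissible K E2 -> (forall A B, r A B -> E1 A) ->
    (forall A A' B, r A B -> r A' B -> A = A') ->
    (forall A, E1 A -> exists2 B, E2 B & r A B) ->
    (forall D, D `<=` E1 `|` E2 -> finite_set D ->
       exists x : U t, forall A, D A -> imem x A) ->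
    exists x : U t, forall A, (E1 `|` E2) A -> imem x A.
  move=> aE2 rE rinj rtot fip.
  have /choice[p pP] : forall B, exists A,
      (E2 B -> (E1 `|` E2) A) /\ (forall A', r A' B -> A' = A).
    move=> B; have [[A rA]|nr] := pselect (exists A, r A B).
      by exists A; split=> [_|A' rA']; [left; exact: rE rA|exact: rinj rA' rA].
    by exists B; split=> [|A rA]; [right|case: nr; exists A].
  have [||x xP] := @saturation _ _ _ U _ ((fun B => isetI B (p B)) @` E2).
  - exact: admissible_image.
  - move=> D DE fD.
    have /choice[q qP] : forall A, exists B, D A -> E2 B /\ isetI B (p B) = A.
      move=> A; have [/DE[B E2B <-]|nD] := pselect (D A); first by exists B.
      by exists A.
    have [||x xP] := fip (q @` D `|` (p \o q) @` D).
    + by move=> _ [[A /qP[E2q _] <-]|[A /qP[E2q _] <-]]; [right|exact: (pP _).1].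
    + by rewrite finite_setU; split; exact: finite_image.
    exists x => A DA; have [_ <-] := qP A DA; apply/imem_setI.
    by split; apply: xP; [left; exists A|right; exists A].
  exists x => A [/rtot[B E2B rAB]|E2A].
    have /imem_setI[_] := xP _ (ex_intro2 _ _ B E2B erefl).
    by have [_ /(_ _ rAB) ->] := pP B.
  by have /imem_setI[] := xP _ (ex_intro2 _ _ A E2A erefl).
move=> aF1 aF2 fip; have [r [rF rfun rinj [rtot|rtot]]] := matching F1 F2.
  apply: (half (fun A B => r (A, B)) F1 F2) => //.
  - by move=> A B /rF[].
  - by move=> A /rtot[B rAB]; exists B => //; have [] := rF _ _ rAB.
rewrite setUC; apply: (half (fun A B => r (B, A)) F2 F1) => //.
- by move=> A B /rF[].
- by move=> A A' B; exact: rfun.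
- by move=> A /rtot[B rAB]; exists B => //; have [] := rF _ _ rAB.
- by rewrite setUC.
Qed.

End InternalSets.

Section Trace.
Variables (K X : Type) (R : realType) (U : nonstandard_universe K X R).
Variables (t : styp) (G : hyperfinite_abelian_group U t) (T : triplet G).
Local Notation G0 := (G0 T).
Local Notation Gf := (Gf T).

Lemma subgroupD (S : set (gelt G)) x y : subgroup S -> S x -> S y -> S (x + y).
Proof.
move=> [S0 SB] Sx Sy; rewrite -[y]opprK; apply: (SB) => //.
by rewrite -sub0r; exact: SB.
Qed.

Lemma subgroupN (S : set (gelt G)) x : subgroup S -> S x -> S (- x).
Proof. by move=> [S0 SB] Sx; rewrite -sub0r; exact: SB. Qed.

Lemma internal_between : exists A : U (tPow t), G0 `<=` ext A /\ ext A `<=` Gf.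
Proof.
have [F0 [aF0 G0E]] := G0_monadic T; have [Ff [aFf GfE]] := Gf_galactic T.
apply: contrapT => nA.
have [D DF fD|x xP] := saturationU aF0
    (admissible_image (fun B => isetD (carrier G) B) aFf).
  have /choice[q qP] : forall A, exists B, D A ->
      F0 A \/ Ff B /\ A = isetD (carrier G) B.
    move=> A; have [/DF[?|[B FB <-]]|nD] := pselect (D A).
    - by exists A; left.
    - by exists B; right.
    - by exists A.
  have [B BP] := finite_union_internal (finite_setIl Ff (finite_image q fD)).
  have [x [G0x nBx]] : exists x, G0 x /\ ~ ext B x.
    apply: contrapT => nx; apply: nA; exists B; split=> [x G0x|x].
      by apply: contrapT => nBx; apply: nx; exists x.
    by move=> /BP[A [_ FfA] xA]; rewrite GfE; exists A.
  exists (gval x) => A DA; have [F0A|[FfB AE]] := qP A DA.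
    by move: G0x; rewrite G0E => /(_ _ F0A).
  rewrite AE; apply/imem_setD; split; first exact: gvalP.
  by move=> xB; apply: nBx; apply/BP; exists (q A) => //; split=> //; exists A.
have := (Gf_subgroup T).1; rewrite GfE => -[B0 FfB0 _].
have /imem_setD[xG _] : imem x (isetD (carrier G) B0).
  by apply: xP; right; exists B0.
have : Gf (GElt xG).
  by apply: (@G0_sub_Gf _ _ _ _ _ _ T); rewrite G0E => A F0A; apply: xP; left.
rewrite GfE => -[B FfB xB].
have /imem_setD[_] : imem x (isetD (carrier G) B) by apply: xP; right; exists B.
exact.
Qed.

Definition coset (x : gelt G) : set (gelt G) := [set y | G0 (y - x)].

Lemma coset_eqP x y : coset x = coset y <-> G0 (x - y).
Proof.
have [G00 _] := G0_subgroup T; split=> [|xy].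
  by move=> /(congr1 (@^~ x)); rewrite /coset /= subrr => <-.
apply/seteqP; split=> z; rewrite /coset /=.
  move=> zx; have -> : z - y = (z - x) + (x - y) by rewrite addrA subrK.
  exact: subgroupD (G0_subgroup T) zx xy.
move=> zy; have -> : z - x = (z - y) + - (x - y) by rewrite opprB addrA subrK.
apply: subgroupD (G0_subgroup T) zy _.
exact: subgroupN (G0_subgroup T) xy.
Qed.

(* the observable trace Gf / G0, an element being a coset of G0 *)
Record trace : Type := Trace {
  trace_set :> set (gelt G);
  trace_setP : exists2 x, Gf x & trace_set = coset x }.

Lemma trace_set_inj : injective trace_set.
Proof.
move=> [Y YP] [Z ZP] /= e; move: YP ZP; rewrite e => YP ZP.
by rewrite (Prop_irrelevance YP ZP).
Qed.

Definition flat (x : gelt G) (hx : Gf x) : trace :=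
  Trace (ex_intro2 _ _ x hx erefl).

Definition rep (Y : trace) : gelt G := projT1 (cid2 (trace_setP Y)).

Lemma rep_Gf Y : Gf (rep Y).
Proof. by rewrite /rep; case: cid2. Qed.

Lemma flat_eqP x y (hx : Gf x) (hy : Gf y) : flat hx = flat hy <-> G0 (x - y).
Proof.
rewrite -coset_eqP; split=> [/(congr1 trace_set)//|e].
exact: trace_set_inj.
Qed.

Lemma repK Y : flat (rep_Gf Y) = Y.
Proof. by apply: trace_set_inj => /=; rewrite /rep; case: cid2. Qed.

HB.instance Definition _ := gen_eqMixin trace.
HB.instance Definition _ := gen_choiceMixin trace.

Definition trace_add (Y Z : trace) : trace :=
  flat (subgroupD (Gf_subgroup T) (rep_Gf Y) (rep_Gf Z)).
Definition trace_zero : trace := flat (proj1 (Gf_subgroup T)).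
Definition trace_opp (Y : trace) : trace :=
  flat (subgroupN (Gf_subgroup T) (rep_Gf Y)).

Lemma rep_flat x (hx : Gf x) : G0 (rep (flat hx) - x).
Proof. by apply/(flat_eqP (rep_Gf _) hx); rewrite repK. Qed.

Lemma trace_addE x y (hx : Gf x) (hy : Gf y) (hxy : Gf (x + y)) :
  trace_add (flat hx) (flat hy) = flat hxy.
Proof.
apply/flat_eqP; rewrite opprD addrACA.
by apply: subgroupD; [exact: G0_subgroup|exact: rep_flat|exact: rep_flat].
Qed.

Lemma trace_oppE x (hx : Gf x) (hNx : Gf (- x)) : trace_opp (flat hx) = flat hNx.
Proof.
apply/flat_eqP; rewrite -opprD; apply: subgroupN; first exact: G0_subgroup.
exact: rep_flat.
Qed.

Let flatP (Y : trace) : exists x (hx : Gf x), Y = flat hx.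
Proof. by exists (rep Y), (rep_Gf Y); rewrite repK. Qed.

Let flat_cong x y (hx : Gf x) (hy : Gf y) : x = y -> flat hx = flat hy.
Proof. by move=> e; apply/flat_eqP; rewrite e subrr; exact: (G0_subgroup T).1. Qed.

Lemma trace_addA : associative trace_add.
Proof.
move=> Y Z W; have [x [hx ->]] := flatP Y; have [y [hy ->]] := flatP Z.
have [z [hz ->]] := flatP W; have hG := Gf_subgroup T.
rewrite (trace_addE _ _ (subgroupD hG hy hz)) (trace_addE _ _ (subgroupD hG hx hy)).
rewrite (trace_addE _ _ (subgroupD hG hx (subgroupD hG hy hz))).
rewrite (trace_addE _ _ (subgroupD hG (subgroupD hG hx hy) hz)).
by apply: flat_cong; rewrite addrA.
Qed.

Lemma trace_addC : commutative trace_add.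
Proof. by move=> Y Z; apply: flat_cong; rewrite addrC. Qed.

Lemma trace_add0 : left_id trace_zero trace_add.
Proof.
move=> Y; have [x [hx ->]] := flatP Y.
rewrite (trace_addE _ _ (subgroupD (Gf_subgroup T) (Gf_subgroup T).1 hx)).
by apply: flat_cong; rewrite add0r.
Qed.

Lemma trace_addN : left_inverse trace_zero trace_opp trace_add.
Proof.
move=> Y; have [x [hx ->]] := flatP Y; have hG := Gf_subgroup T.
rewrite (trace_oppE _ (subgroupN hG hx)).
rewrite (trace_addE _ _ (subgroupD hG (subgroupN hG hx) hx)).
by apply: flat_cong; rewrite addNr.
Qed.

HB.instance Definition _ :=
  GRing.isZmodule.Build trace trace_addA trace_addC trace_add0 trace_addN.

Lemma flatD x y (hx : Gf x) (hy : Gf y) (hxy : Gf (x + y)) :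
  flat hx + flat hy = flat hxy.
Proof. exact: trace_addE. Qed.

HB.instance Definition _ := isPointed.Build trace 0.

Definition trace_open (Y : set trace) : Prop :=
  forall x (hx : Gf x), Y (flat hx) ->
    exists A : U (tPow t), coset x `<=` ext A /\
      ext A `<=` [set y | exists hy : Gf y, Y (flat hy)].

Lemma trace_openT : trace_open setT.
Proof.
move=> x hx _; have [D [G0D DGf]] := internal_between.
exists (itranslate (gadd G) (gopp G) (gval x) D); split=> y.
  by move=> /G0D ?; apply/imem_translate.
move=> /imem_translate Dyx; suff hy : Gf y by exists hy.
rewrite -(subrK x y); apply: subgroupD (Gf_subgroup T) _ hx.
exact: DGf.
Qed.

Lemma trace_openI : setI_closed trace_open.
Proof.
move=> Y Z oY oZ x hx [/oY[A [xA AY]] /oZ[B [xB BZ]]].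
exists (isetI A B); split=> y.
  by move=> xy; apply/imem_setI; split; [exact: xA|exact: xB].
move=> /imem_setI[/AY[hy Yy] /BZ[hy' Zy]]; exists hy; split=> //.
by rewrite (Prop_irrelevance hy hy').
Qed.

Lemma trace_open_bigU (I : Type) (f : I -> set trace) :
  (forall i, trace_open (f i)) -> trace_open (\bigcup_i f i).
Proof.
move=> of_ x hx [i _ /of_[A [xA AY]]]; exists A; split=> // y /AY[hy fy].
by exists hy, i.
Qed.

HB.instance Definition _ :=
  isOpenTopological.Build trace trace_openT trace_openI trace_open_bigU.

Lemma trace_openE : @open trace = trace_open.
Proof. by []. Qed.

End Trace.

Section ComplexMeasures.
Variables (K X : Type) (R : realType) (U : nonstandard_universe K X R).
Variables (t : styp) (G : hyperfinite_abelian_group U t) (T : triplet G).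

Local Notation borel := (g_sigma_algebraType (@open (trace T))).

(* A complex Borel measure, through its real and imaginary parts, which are
   finite signed measures. *)
Record complex_measure : Type := ComplexMeasure {
  re_part : {charge set borel -> \bar R};
  im_part : {charge set borel -> \bar R} }.

Definition cmeas (mu : complex_measure) (A : set borel) : R[i] :=
  (fine (re_part mu A) +i* fine (im_part mu A))%C.

Definition total_variation (mu : complex_measure) (E : set borel) : \bar R :=
  ereal_sup [set v | exists (n : nat) (F : 'I_n -> set borel),
    [/\ forall i, measurable (F i), trivIset setT F, \bigcup_i F i `<=` E &
        v = (\sum_(i < n) Normc.normc (cmeas mu (F i)))%:E]].

(* membership in M(trace T) *)
Definition regular_measure (mu : complex_measure) : Prop :=
  (total_variation mu setT < +oo)%E /\
  forall E : set borel, measurable E -> forall e : R, 0 < e ->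
    exists C O : set (trace T), [/\ compact C, open O, C `<=` E, E `<=` O &
      (total_variation mu (O `\` C) < e%:E)%E].

Definition charge_integral (nu : {charge set borel -> \bar R})
    (f : borel -> R) : R :=
  let: exist P hP := cid (Hahn_decomposition nu) in
  let: exist N hPN := cid hP in
  \int[jordan_pos hPN]_x f x - \int[jordan_neg hPN]_x f x.

Definition cintegral (mu : complex_measure) (f : trace T -> R[i]) : R[i] :=
  let u x := complex.Re (f x) in let v x := complex.Im (f x) in
  ((charge_integral (re_part mu) u - charge_integral (im_part mu) v) +i*
   (charge_integral (im_part mu) u + charge_integral (re_part mu) v))%C.

(* the dual group of the observable trace *)
Definition trace_dual : set (trace T -> R[i]) :=
  [set chi | [/\ continuous (chi : trace T -> R[i]^o),
    forall Y, `|chi Y| = 1 & forall Y Z, chi (Y + Z) = chi Y * chi Z]].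

Definition fourier_stieltjes (mu : complex_measure) (chi : trace T -> R[i]) : R[i] :=
  cintegral mu (fun Y => (chi Y)^*).

(* Uniform continuity refers to the topology of uniform convergence on compact
   sets: {chi | |chi - 1| < delta on C} is a basic neighbourhood of the unit. *)
Definition trace_dual_Cbu (phi : (trace T -> R[i]) -> R[i]) : Prop :=
  (exists M : R, forall chi, trace_dual chi -> Normc.normc (phi chi) <= M) /\
  forall e : R, 0 < e -> exists C (delta : R), [/\ compact C, 0 < delta &
    forall chi psi, trace_dual chi -> trace_dual psi ->
      (forall Y, C Y -> Normc.normc (chi Y * (psi Y)^-1 - 1) < delta) ->
      Normc.normc (phi chi - phi psi) < e].

End ComplexMeasures.

Section FunctionSpaces.
Variables (K X : Type) (R : realType) (U : nonstandard_universe K X R).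
Variables (t : styp) (G : hyperfinite_abelian_group U t) (T : triplet G).
Local Notation I := (interp X R).
Local Notation fnC := (tFun t tCplx).

Definition between (A : U (tPow t)) : Prop :=
  [/\ internal_subset G A, G0 T `<=` ext A & ext A `<=` Gf T].

Definition finite_noninfinitesimal (a : U tReal) : Prop :=
  finite_r a /\ ~ infinitesimal_r a.

Definition condensing : Prop :=
  forall (A B : U (tPow t)) (m n : U tNat),
    between A -> between B -> internal_card A m -> internal_card B n ->
    finite_noninfinitesimal (hdivr (hnat_real m) (hnat_real n)).

Definition normalizing_multiplier (d : U tReal) : Prop :=
  hlt (hreal U 0) d /\
  exists (A : U (tPow t)) (n : U tNat),
    [/\ between A, internal_card A n &
        finite_noninfinitesimal (hmulr d (hnat_real n))].

(* Internal functions G -> *C are elements of [U fnC]; only their values on the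
   carrier of G matter. *)

(* The value |f| is bounded by a finite hyperreal on the hyperfinite set [P],
   i.e. its maximum is finite. *)
Definition finite_max s (P : set (U s)) (f : U (tFun s tCplx)) : Prop :=
  exists M : U tReal, lt_infty M /\ forall x, P x -> hle (hnormc (iapp f x)) M.

Definition norm1 (d : U tReal) (g : U fnC) : U tReal :=
  @lift3 K X R U tReal (tPow t) fnC tReal
    (fun d A g => d * \sum_(x \in (A : set {classic I t})) Normc.normc (g x))
    d (carrier G) g.

Definition cutoff (g : U fnC) (Z : U (tPow t)) : U fnC :=
  @lift2 K X R U fnC (tPow t) fnC
    (fun g Z x => if `[< Z x >] then g x else 0) g Z.

Definition Mspace (d : U tReal) (g : U fnC) : Prop :=
  lt_infty (norm1 d g) /\
  forall Z : U (tPow t), internal_subset G Z -> ext Z `<=` ~` Gf T ->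
    infinitesimal_r (norm1 d (cutoff g Z)).

Definition C0space (f : U fnC) : Prop :=
  [/\ finite_max [set x | imem x (carrier G)] f,
      forall x y : gelt G, Gf T x -> Gf T y -> G0 T (x - y) ->
        approx (iapp f x) (iapp f y) &
      forall x : gelt G, ~ Gf T x -> approx (iapp f x) (hcplx U 0)].

(* f^flat, for a function [f] that is finite and G0-continuous on Gf *)
Definition flat_fun (f : U fnC) (Y : trace T) : R[i] := stpart (iapp f (rep Y)).

Definition pairing (d : U tReal) (f g : U fnC) : U tCplx :=
  iapp (@lift3 K X R U tReal (tPow t) fnC (tFun fnC tCplx)
    (fun d A f g => d%:C%C * \sum_(x \in (A : set {classic I t})) f x * g x)
    d (carrier G) f) g.

Definition weak_lifting (d : U tReal) (g : U fnC) (mu : complex_measure T) : Prop :=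
  forall f : U fnC, C0space f ->
    finite_c (pairing d f g) /\
    cintegral mu (flat_fun f) = stpart (pairing d f g).

(* The internal dual group of G.  An internal character is represented by its
   extension by 0 outside G, so that distinct elements are distinct characters. *)
Definition hdual : set (U fnC) :=
  [set gamma | [/\
    forall x : gelt G, imem (iapp gamma x)
      (icst U (t := tPow tCplx) [set z : R[i] | `|z| = 1]),
    forall x y : gelt G, iapp gamma (x + y) = hmulc (iapp gamma x) (iapp gamma y) &
    forall x : U t, ~ imem x (carrier G) -> iapp gamma x = hcplx U 0]].

Definition hdual_div (gamma chi : U fnC) : U fnC :=
  @lift2 K X R U fnC fnC fnC (fun gamma chi x => gamma x / chi x) gamma chi.

Definition polar (A : set (gelt G)) : set (U fnC) :=
  [set gamma | hdual gamma /\
    forall a, A a -> approx (iapp gamma a) (hcplx U 1)].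

Definition hdual_Cbu (h : U (tFun fnC tCplx)) : Prop :=
  finite_max hdual h /\
  forall gamma chi, hdual gamma -> hdual chi ->
    polar (Gf T) (hdual_div gamma chi) -> approx (iapp h gamma) (iapp h chi).

Definition dft (d : U tReal) (g : U fnC) : U (tFun fnC tCplx) :=
  @lift3 K X R U tReal (tPow t) fnC (tFun fnC tCplx)
    (fun d A g gamma =>
       d%:C%C * \sum_(x \in (A : set {classic I t})) g x * (gamma x)^*)
    d (carrier G) g.

End FunctionSpaces.

Arguments trace_dual {K X R U t G} T _.
Arguments flat_fun {K X R U t G} T f Y.

(* Main.v *)
Require Import Defs.
From mathcomp Require Import all_boot all_order all_algebra.
From mathcomp Require Import all_classical all_reals all_analysis.
From mathcomp Require Import complex.
From mathcomp Require Import measurable_realfun.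
From mathcomp Require Import ring lra.

(** Both Fourier transforms integrate a character against a measure, and a
    character [gamma] which is infinitely close to 1 on [G0] would be a test
    function for the weak lifting, were it infinitesimal outside [Gf].  So the
    proof truncates it: [gamma] is multiplied by an internal cutoff [u] with
    values in the unit interval, equal to 1 on an internal set [B] inside [Gf],
    equal to 0 outside [Gf], and infinitesimally varying along [G0]
    ([cutoff_exists]).  The conjugate of [gamma * u] is in [C0space], hence its
    pairing with [g] has standard part the integral of its trace.  Truncating
    costs little on both sides if [B] is large enough: on the internal side,
    saturation yields an internal [B] inside [Gf] outside which [g] has small
    1-norm ([Mspace_tight]); on the standard side, regularity of [mu] yields a
    compact set carrying almost all of the variation, and a compact set is
    covered by the trace of one internal set ([compact_internal]).  Since the two
    sides of the claimed equality do not depend on [B], they are equal.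

    The cutoff is a nonstandard Urysohn function.  Saturation halves internal
    neighbourhoods of [G0]: for each internal [D] containing [G0] there is an
    internal [V] containing [G0] with [V + V] inside [D] ([halving]).  This gives
    a sequence [V_n] with [V_(n+1) + V_(n+1)] inside [V_n], along which the
    classical dyadic construction makes, for each [N], a function varying by at
    most [2^-n] along [V_n] for every [n <= N] ([urysohn]); countable saturation
    then provides one internal function good for all [n] ([urysohn_internal]).

    The two remaining claims come from the same kind of estimate.  If [gamma] and
    [chi] agree up to infinitesimals on [Gf], then the internal set on which they
    differ by more than a standard [e] misses [Gf], so that [g] is negligible
    there ([dft_close], [dft_Cbu]).  If two characters of the trace are close on
    a compact set carrying almost all of the variation of [mu], then their
    integrals are close ([cintegral_close], [fourier_stieltjes_Cbu]). *)

Set Implicit Arguments.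
Unset Strict Implicit.
Unset Printing Implicit Defensive.
Import Order.TTheory GRing.Theory Num.Theory.
Import numFieldNormedType.Exports.
Local Open Scope classical_set_scope.
Local Open Scope card_scope.
Local Open Scope ring_scope.
Local Notation normc := Normc.normc.
(* both names also denote other notions of analysis *)
Local Notation approx := Defs.approx.
Local Notation total_variation := Defs.total_variation.

(** * Transfer by reflection *)

(** For a standard [e]: [approx a b] unfolds to [close e a b] for all [e > 0]. *)
Definition close (K X : Type) (R : realType) (U : nonstandard_universe K X R)
    (e : R) (a b : U tCplx) : Prop :=
  hlt (habsr (hnormc (hsubc a b))) (hreal U e).

(** A statement about [U] built from [->], [forall], [False], [=] and [imem] is
    convertible to [sat q tt] for a closed formula [q], and [sat q tt] in the
    standard model is the same statement about standard objects.  The tactics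
    below compute [q] from the goal; [by_transfer] then leaves the standard
    statement to prove.  Everything else is brought into this fragment:
    existential conclusions are stated as double negations, and standard sets and
    operations enter as constants of the formula. *)
Ltac reify_var e x :=
  lazymatch e with
  | (x, _) => uconstr:(var0 _ _)
  | (_, ?e') => let v := reify_var e' x in uconstr:(varS _ v)
  end.

Ltac reify_term X R e a :=
  lazymatch a with
  | @iapp _ _ _ ?s ?t ?f ?b =>
      let f' := reify_term X R e f in
      let b' := reify_term X R e b in
      uconstr:(@TApp X R _ s t f' b')
  | @ipair _ _ _ ?s ?t ?b ?c =>
      let b' := reify_term X R e b in
      let c' := reify_term X R e c in
      uconstr:(@TPair X R _ s t b' c')
  | @icst _ _ _ ?t ?c => uconstr:(@TCst X R _ t c)
  | _ => let v := reify_var e a in uconstr:(@TVar X R _ _ v)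
  end.

Ltac reify X R Gam e P :=
  lazymatch P with
  | False => constr:(@FBot X R Gam)
  | @imem _ _ _ ?t ?a ?A =>
      let a' := reify_term X R e a in
      let A' := reify_term X R e A in
      constr:(@FMem X R Gam t a' A')
  | @eq (idom _ ?t) ?a ?b =>
      let a' := reify_term X R e a in
      let b' := reify_term X R e b in
      constr:(@FEq X R Gam t a' b')
  | ?A -> ?B =>
      let A' := reify X R Gam e A in
      let B' := reify X R Gam e B in
      constr:(@FImp X R Gam A' B')
  | forall x : idom ?M ?t, @?Q x =>
      (* without a fresh name, nested binders of the same name would capture *)
      let y := fresh x in
      let q := constr:(fun y : idom M t => ltac:(
        let Qy := eval cbv beta in (Q y) in
        let q := reify X R constr:(t :: Gam) constr:((y, e)) Qy in exact q)) in
      lazymatch q with fun _ => ?q' => constr:(@FAll X R Gam t q') end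
  end.

Ltac by_transfer :=
  cbv beta delta [close not hle hlt habsr hsubc hmulc hnormc hreal hcplx hnat_le
    lift1 lift2 lift3 lift_rel norm1 cutoff pairing dft hdual_div];
  lazymatch goal with
  | U : nonstandard_universe ?K ?X ?R |- ?P =>
      let q := reify X R constr:(@nil styp) constr:(tt) P in
      refine (proj1 (@transfer K X R U q) _);
      cbn [sat teval lookup standard_model idom icst iapp ipair imem interp
        fst snd]
  end.

(** * Hyperreal and hypercomplex numbers *)

Section Normc.
Variable R : rcfType.
Implicit Types a b c : R[i].

Lemma normc_ge0 a : 0 <= normc a.
Proof. by case: a => x y /=; exact: sqrtr_ge0. Qed.

Lemma normcD_le a b : normc (a + b) <= normc a + normc b.
Proof. exact: le_normcD. Qed.

Lemma normcNE a : normc (- a) = normc a.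
Proof. exact: normcN. Qed.

Lemma normcB_sym a b : normc (a - b) = normc (b - a).
Proof. by rewrite -normcNE opprB. Qed.

Lemma normcB_tri a b c : normc (a - c) <= normc (a - b) + normc (b - c).
Proof. by rewrite -[a - c](subrKA b) normcD_le. Qed.

Lemma normc_conj a : normc (a^*) = normc a.
Proof. by case: a => x y; rewrite /= sqrrN. Qed.

Lemma normc_real (x : R) : normc (x%:C)%C = `|x|.
Proof. by rewrite /= expr0n addr0 sqrtr_sqr. Qed.

Lemma Re_le_normc a : `|complex.Re a| <= normc a.
Proof. by rewrite -lecR; exact: normc_ge_Re. Qed.

Lemma Im_le_normc a : `|complex.Im a| <= normc a.
Proof.
case: a => x y /=; rewrite -sqrtr_sqr ler_wsqrtr // lerDr sqr_ge0 //.
Qed.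

Lemma normc_le_ReIm a : normc a <= `|complex.Re a| + `|complex.Im a|.
Proof.
case: a => x y /=; have -> : `|x| + `|y| = Num.sqrt ((`|x| + `|y|) ^+ 2).
  by rewrite sqrtr_sqr [RHS]ger0_norm ?addr_ge0.
rewrite ler_wsqrtr // sqrrD !real_normK ?num_real // lerD2r lerDl.
by rewrite mulrn_wge0 // mulr_ge0.
Qed.

Lemma normr_normc a : `|a| = ((normc a)%:C)%C.
Proof. by []. Qed.

Lemma normr1_normc a : (`|a| = 1) <-> (normc a = 1).
Proof. by rewrite normr_normc; split=> [[]|->]. Qed.

End Normc.

Section Hyper.
Variables (K X : Type) (R : realType) (U : nonstandard_universe K X R).
Implicit Types (a b c : U tCplx) (e : R).

Lemma close_refl e a : 0 < e -> close e a a.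
Proof.
move=> e0; move: a; by_transfer => a.
by rewrite subrr Normc.normc0 normr0.
Qed.

Lemma close_sym e a b : close e a b -> close e b a.
Proof. by move: a b; by_transfer => a b; rewrite normcB_sym. Qed.

Lemma close_tri e1 e2 a b c :
  close e1 a b -> close e2 b c -> close (e1 + e2) a c.
Proof.
move: a b c; by_transfer => a b c.
rewrite !ger0_norm ?normc_ge0 // => ab bc.
by rewrite (le_lt_trans (normcB_tri a b c)) // ltrD.
Qed.

Lemma close_le e1 e2 a b : e1 <= e2 -> close e1 a b -> close e2 a b.
Proof. by move=> e12; move: a b; by_transfer => a b /lt_le_trans; apply. Qed.

Lemma close_cst e (x y : R[i]) :
  close e (hcplx U x) (hcplx U y) <-> normc (x - y) < e.
Proof.
split; last first.
  move=> xy; by_transfer; rewrite ger0_norm ?normc_ge0 //.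
move=> h; apply: contrapT => nxy; move: h; by_transfer.
by rewrite ger0_norm ?normc_ge0.
Qed.

Lemma approx_sym a b : approx a b -> approx b a.
Proof. by move=> ab e e0; apply: close_sym; exact: ab. Qed.

Lemma approx_trans a b c : approx a b -> approx b c -> approx a c.
Proof.
move=> ab bc e e0; rewrite (splitr e).
by apply: (close_tri (b := b)); [apply: ab|apply: bc]; rewrite divr_gt0.
Qed.

Lemma approx_cst_inj (x y : R[i]) : approx (hcplx U x) (hcplx U y) -> x = y.
Proof.
move=> xy; apply/eqP; rewrite -subr_eq0; apply/eqP/Normc.eq0_normc/eqP.
rewrite eq_le normc_ge0 andbT; apply/ler_addgt0Pl => e e0.
by rewrite addr0 ltW //; apply/close_cst; exact: xy.
Qed.

Lemma stpart_eq a (x : R[i]) : approx a (hcplx U x) -> stpart a = x.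
Proof.
move=> ax; rewrite /stpart; case: xgetP => [y _ ay|/(_ x)//].
by apply: approx_cst_inj; apply: approx_trans ax; exact: approx_sym.
Qed.

Lemma hle_cst (x y : R) : hle (hreal U x) (hreal U y) -> x <= y.
Proof. by move=> h; apply: contrapT => nxy; move: h; by_transfer. Qed.

Definition hRe : U tCplx -> U tReal := @lift1 _ _ _ U tCplx tReal (@complex.Re R).
Definition hIm : U tCplx -> U tReal := @lift1 _ _ _ U tCplx tReal (@complex.Im R).

(** By completeness of the real line: [y] is the supremum of the standard numbers
    below [x]. *)
Lemma finite_near (x : U tReal) : finite_r x ->
  exists y : R, forall e, 0 < e ->
    hle (hreal U (y - e)) x /\ hle x (hreal U (y + e)).
Proof.
move=> [r xr]; pose S : set R := [set s | hle (hreal U s) x].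
have Sub : ubound S r.
  move=> s Ss; apply: hle_cst; move: Ss xr; rewrite /S /=.
  move: x {S}; by_transfer => x sx; apply: le_trans.
  exact: le_trans sx (ler_norm x).
have S0 : S !=set0.
  exists (- r); rewrite /S /=; move: x xr {S Sub}; by_transfer => x.
  by rewrite ler_norml => /andP[].
have hS : has_sup S by split=> //; exists r.
exists (sup S) => e e0; split.
  have [s Ss lts] := sup_adherent e0 hS.
  move: (sup S) lts Ss => y; rewrite /S /= => lts {S Sub S0 hS xr}.
  move: x; by_transfer => x; exact/le_trans/ltW.
apply: contrapT => nle; have /(ub_le_sup (conj S0 (ex_intro _ r Sub)).2) : S (sup S + e).
  move: (sup S) nle => y; rewrite /S /= => {S Sub S0 hS xr}.
  move: x; by_transfer => x.
  by move/negP; rewrite -ltNge => /ltW.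
by rewrite gerDl leNgt e0.
Qed.

Lemma close_ReIm (z : U tCplx) (x y e : R) :
  hle (hreal U (x - e)) (hRe z) -> hle (hRe z) (hreal U (x + e)) ->
  hle (hreal U (y - e)) (hIm z) -> hle (hIm z) (hreal U (y + e)) ->
  0 < e -> close (e *+ 3) z (hcplx U (x +i* y)%C).
Proof.
move=> + + + + e0; rewrite /hRe /hIm; move: z; by_transfer => -[a b] /= h1 h2 h3 h4.
rewrite ger0_norm ?sqrtr_ge0 //; apply: le_lt_trans (normc_le_ReIm (Complex (a - x) (b - y))) _.
have : `|a - x| <= e by rewrite ler_norml; apply/andP; split; lra.
have : `|b - y| <= e by rewrite ler_norml; apply/andP; split; lra.
move=> /=; lra.
Qed.

Lemma hRe_finite (z : U tCplx) : finite_c z -> finite_r (hRe z).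
Proof.
move=> [r zr]; exists r; move: z zr; rewrite /hRe; by_transfer => z.
rewrite (ger0_norm (normc_ge0 z)); apply: le_trans; exact: Re_le_normc.
Qed.

Lemma hIm_finite (z : U tCplx) : finite_c z -> finite_r (hIm z).
Proof.
move=> [r zr]; exists r; move: z zr; rewrite /hIm; by_transfer => z.
rewrite (ger0_norm (normc_ge0 z)); apply: le_trans; exact: Im_le_normc.
Qed.

Lemma approx_stpart (z : U tCplx) : finite_c z -> approx z (hcplx U (stpart z)).
Proof.
move=> fz; suff [x zx] : exists x, approx z (hcplx U x) by rewrite (stpart_eq zx).
have [x hx] := finite_near (hRe_finite fz).
have [y hy] := finite_near (hIm_finite fz).
exists (x +i* y)%C => e e0.
have e40 : 0 < e / 4 by rewrite divr_gt0.
apply: (close_le _ (close_ReIm (hx _ e40).1 (hx _ e40).2 (hy _ e40).1 (hy _ e40).2 e40)).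
lra.
Qed.

Lemma finite_bound (z : U tCplx) (r : R) : hle (hnormc z) (hreal U r) -> finite_c z.
Proof.
move=> zr; exists r; move: z zr; by_transfer => z.
by rewrite (ger0_norm (normc_ge0 z)).
Qed.

Lemma normc_stpart_le (z : U tCplx) (r : R) :
  hle (hnormc z) (hreal U r) -> normc (stpart z) <= r.
Proof.
move=> zr; apply/ler_addgt0Pl => e e0.
have := approx_stpart (finite_bound zr) e0; move: (stpart z) => x.
move=> h; rewrite leNgt; apply/negP => xr; move: z zr h; by_transfer => z zr zx.
move: zx; rewrite (ger0_norm (normc_ge0 _)) ltNge; case/negP.
have := normcB_tri x z 0; rewrite !subr0 normcB_sym; lra.
Qed.

End Hyper.

(** * Estimates for the internal Fourier transform *)

Section Sums.
Variables (R : realType) (T : choiceType) (A : set T).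
Hypothesis finA : finite_set A.

Lemma normc_fsum_le (d : R) (F : T -> R[i]) (b : T -> R) :
  0 <= d -> (forall x, A x -> normc (F x) <= b x) ->
  normc (d%:C%C * \sum_(x \in A) F x) <= d * \sum_(x \in A) b x.
Proof.
move=> d0 Fb; rewrite Normc.normcM normc_real ger0_norm // ler_wpM2l //.
rewrite !fsbig_finite //= !big_seq.
elim/big_ind2: _ => [|x a y c xa yc|x xA]; first by rewrite Normc.normc0.
  exact: le_trans (normcD_le _ _) (lerD xa yc).
by apply: Fb; move: xA; rewrite in_fset_set // inE.
Qed.

(** The bound on the terms is the one satisfied by the products of [g] with two
    kernels of modulus at most 1 that are [e]-close off [Z]. *)
Lemma normc_fsumB_le (d e : R) (F1 F2 g : T -> R[i]) (Z : set T) :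
  0 <= d -> (forall x, A x -> normc (F1 x - F2 x) <=
    e * normc (g x) + 2 * normc (if `[< Z x >] then g x else 0)) ->
  normc (d%:C%C * \sum_(x \in A) F1 x - d%:C%C * \sum_(x \in A) F2 x) <=
    e * (d * \sum_(x \in A) normc (g x)) +
    2 * (d * \sum_(x \in A) normc (if `[< Z x >] then g x else 0)).
Proof.
move=> d0 Fb; rewrite -mulrBr.
rewrite mulrCA [2 * (d * _)]mulrCA -mulrDr !mulr_fsumr -fsbig_split //=.
have -> : \sum_(x \in A) F1 x - \sum_(x \in A) F2 x = \sum_(x \in A) (F1 x - F2 x).
  by rewrite !fsbig_finite //= sumrB.
exact: normc_fsum_le.
Qed.
End Sums.

Section Dft.
Variables (K X : Type) (R : realType) (U : nonstandard_universe K X R).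
Variables (t : styp) (G : hyperfinite_abelian_group U t).
Local Notation I := (interp X R).
Local Notation fnC := (tFun t tCplx).
Implicit Types (d : U tReal) (g k f : U fnC).

Definition finite_sets : U (tPow (tPow t)) :=
  icst U (t := tPow (tPow t)) [set A : set (I t) | finite_set A].

(** The internal enumeration exhibits [A] as the image of an initial segment of
    the natural numbers. *)
Lemma internal_card_finite A n : internal_card A n -> imem A finite_sets.
Proof.
move=> [f [_ _ surj_f]].
have {surj_f}f_surj : forall x, imem x A ->
    (forall k : U tNat, hnat_le (icst U (t := tNat) 1%N) k -> hnat_le k n -> iapp f k = x -> False) -> False.
  by move=> x /surj_f[k [k1 kn] <-] /(_ k k1 kn); apply.
rewrite /finite_sets.
move: A n f f_surj; by_transfer => A n f fs.
apply: (@sub_finite_set _ _ (f @` `I_n.+1)); last exact/finite_image/finite_II.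
move=> x /fs h; apply: contrapT => nx; apply: h => k _ kn fk; apply: nx.
by exists k.
Qed.

Lemma carrier_finite : imem (carrier G) finite_sets.
Proof. by have [n /internal_card_finite] := ghyperfinite G. Qed.

Definition le1 k : Prop :=
  forall x, imem x (carrier G) -> hle (hnormc (iapp k x)) (hreal U 1).

Lemma dft_bound d g k : hle (hreal U 0) d -> le1 k ->
  hle (hnormc (iapp (dft G d g) k)) (norm1 G d g).
Proof.
move: carrier_finite; rewrite /le1 /dft /norm1 /finite_sets; move: (carrier G) d g k.
by_transfer => A d g k fA d0 k1; apply: normc_fsum_le => // x Ax.
rewrite Normc.normcM normc_conj.
by rewrite ler_piMr ?normc_ge0 // k1.
Qed.

(** Both the uniform continuity of the transform and the cost of truncating a
    character come down to this: the kernels [k1] and [k2] may differ widely on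
    [Z], but [g] has little mass there. *)
Lemma dft_close d g k1 k2 (Z : U (tPow t)) (m e e' : R) :
  hle (hreal U 0) d -> le1 k1 -> le1 k2 ->
  (forall x, imem x (carrier G) -> ~ imem x Z ->
     hle (hnormc (hsubc (iapp k1 x) (iapp k2 x))) (hreal U e)) ->
  hle (norm1 G d g) (hreal U m) ->
  hlt (norm1 G d (cutoff g Z)) (hreal U e) ->
  0 < e -> e * m + 2 * e <= e' ->
  close e' (iapp (dft G d g) k1) (iapp (dft G d g) k2).
Proof.
move=> + + + + + + e0 me; move: carrier_finite.
rewrite /le1 /dft /norm1 /finite_sets /close; move: (carrier G) d g k1 k2 Z.
by_transfer => A d g k1 k2 Z fA d0 k11 k21 k12 nm ne.
rewrite ger0_norm ?normc_ge0 //; apply: lt_le_trans me.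
apply: (le_lt_trans (@normc_fsumB_le _ {classic interp X R t} _ fA _ e _ _ g Z d0 _)); last first.
  have := ler_wpM2l (ltW e0) nm; lra.
move=> x Ax; rewrite -mulrBr Normc.normcM -rmorphB normc_conj.
case: asboolP => Zx.
  rewrite -mulrDl mulrC; apply: ler_wpM2r; first exact: normc_ge0.
  apply: (le_trans (normcB_tri _ 0 _)); rewrite subr0 sub0r normcNE.
  have := k11 _ Ax; have := k21 _ Ax; lra.
rewrite Normc.normc0 mulr0 addr0 mulrC ler_wpM2r ?normc_ge0 //.
exact: k12.
Qed.

Definition conjf k : U fnC := @lift1 _ _ _ U fnC fnC (fun h x => (h x)^*) k.

(** So a statement about the pairing of [g] with the conjugate of a kernel is one
    about [dft], and [dft_close] serves for both. *)
Lemma pairing_conjf d g k : pairing G d (conjf k) g = iapp (dft G d g) k.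
Proof.
rewrite /pairing /dft /conjf; move: (carrier G) d g k; by_transfer => A d g k.
by congr (_ * _); apply: eq_fsbigr => x _; rewrite mulrC.
Qed.

End Dft.

(** * Integration against a complex measure *)

Section MeasureEstimate.
Context (dd : measure_display) (T : measurableType dd) (R : realType).
Variable m : {finite_measure set T -> \bar R}.

Lemma bounded1_integrable (A : set T) (f : T -> R) (b : R) : measurable A ->
  measurable_fun setT f -> (forall x, `|f x| <= b) ->
  m.-integrable A (EFin \o f).
Proof.
move=> mA mf f1; apply: measurable_bounded_integrable => //.
- by rewrite ltey_eq fin_num_measure.
- exact: measurable_funS mf.
- exists b; split; rewrite ?num_real // => M bM x _ /=.
  exact: le_trans (f1 x) (ltW bM).
Qed.

(** Split the integral of [`|f - g|] at [W]; off [W] this function is at most 2. *)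
Lemma Rintegral_close (f g : T -> R) (W : set T) (delta V eta : R) :
  measurable_fun setT f -> measurable_fun setT g ->
  (forall x, `|f x| <= 1) -> (forall x, `|g x| <= 1) ->
  measurable W -> 0 <= delta -> (forall x, W x -> `|f x - g x| <= delta) ->
  fine (m W) <= V -> fine (m (~` W)) <= eta ->
  `|\int[m]_x f x - \int[m]_x g x| <= delta * V + 2 * eta.
Proof.
move=> mf mg f1 g1 mW d0 fgW mV meta.
have If := bounded1_integrable measurableT mf f1.
have Ig := bounded1_integrable measurableT mg g1.
have h2 x : `|f x - g x| <= 2.
  by apply: le_trans (ler_normB _ _) _; have := f1 x; have := g1 x; lra.
have mh : measurable_fun setT (fun x => f x - g x) by exact: measurable_funB.
have mah : measurable_fun setT (fun x => `|f x - g x|).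
  exact: measurableT_comp.
have ah2 x : `| `|f x - g x| | <= 2 by rewrite normr_id.
rewrite -RintegralB //; apply: le_trans (le_normr_Rintegral _ _) _ => //.
  exact: bounded1_integrable h2.
rewrite -(setUv W) Rintegral_setU //; last 3 first.
- exact: measurableC.
- by rewrite setUv; exact: bounded1_integrable ah2.
- by rewrite disj_set2E setICr.
have step (A : set T) (c v : R) : measurable A -> 0 <= c ->
    (forall x, A x -> `|f x - g x| <= c) -> fine (m A) <= v ->
    \int[m]_(x in A) `|f x - g x| <= c * v.
  move=> mA c0 hc mv; apply: (@le_trans _ _ (\int[m]_(x in A) c)).
    apply: le_Rintegral => //; first exact: bounded1_integrable ah2.
    by apply: (@bounded1_integrable _ _ c) => // x; rewrite ger0_norm.
  by rewrite Rintegral_cst // ler_wpM2l.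
apply: lerD; first exact: step.
by apply: step => //; exact: measurableC.
Qed.

End MeasureEstimate.

Section Charges.
Variables (K X : Type) (R : realType) (U : nonstandard_universe K X R).
Variables (t : styp) (G : hyperfinite_abelian_group U t) (T : triplet G).
Local Notation borel := (g_sigma_algebraType (@open (trace T))).

(** Apply [Rintegral_close] to both Jordan parts, with [W] the measurable set where
    [`|f - g|] is at most [delta]; its complement is contained in [D].  Up to
    sign, a Jordan part of a set is the charge of its intersection with a Hahn set. *)
Lemma charge_integral_close (nu : {charge set borel -> \bar R}) (f g : borel -> R)
    (D : set borel) (delta V eta : R) :
  measurable_fun setT f -> measurable_fun setT g ->
  (forall x, `|f x| <= 1) -> (forall x, `|g x| <= 1) ->
  0 <= delta -> (forall x, ~ D x -> `|f x - g x| <= delta) ->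
  (forall E, measurable E -> `|fine (nu E)| <= V) ->
  (forall E, measurable E -> E `<=` D -> `|fine (nu E)| <= eta) ->
  `|charge_integral nu f - charge_integral nu g| <= 2 * (delta * V + 2 * eta).
Proof.
move=> mf mg f1 g1 d0 fgD nV neta; rewrite /charge_integral.
case: cid => P hP; case: cid => N hPN.
pose W := [set x | `|f x - g x| <= delta].
have mW : measurable W.
  have mh : measurable_fun setT (fun x => `|f x - g x|).
    by apply: measurableT_comp => //; exact: measurable_funB.
  have -> : W = setT `&` (fun x => `|f x - g x|) @^-1` `]-oo, delta].
    by apply/seteqP; split=> x; rewrite /= in_itv /=; [|case].
  exact: mh.
have WD E : E `<=` ~` W -> E `<=` D.
  by move=> EW x /EW nWx; apply: contrapT => /fgD.
have [[mP _] [mN _] _ _] := hPN.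
have posE E : measurable E -> fine (jordan_pos hPN E) <= `|fine (nu (E `&` P))|.
  by move=> mE; rewrite jordan_posE cjordan_posE /crestr0 mem_set // ler_norm.
have negE E : measurable E -> fine (jordan_neg hPN E) <= `|fine (nu (E `&` N))|.
  move=> mE; rewrite jordan_negE cjordan_negE /crestr0 mem_set // fineN.
  by rewrite -[leRHS]normrN ler_norm.
have mCW := measurableC mW.
have Hp := @Rintegral_close _ _ _ (jordan_pos hPN) f g W delta V eta mf mg f1 g1 mW d0.
have Hn := @Rintegral_close _ _ _ (jordan_neg hPN) f g W delta V eta mf mg f1 g1 mW d0.
have {}Hp : `|\int[jordan_pos hPN]_x f x - \int[jordan_pos hPN]_x g x| <= delta * V + 2 * eta.
  apply: Hp => //; first exact/(le_trans (posE _ mW))/nV/measurableI.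
  apply/(le_trans (posE _ mCW))/neta; first exact: measurableI.
  by apply: WD => x [].
have {}Hn : `|\int[jordan_neg hPN]_x f x - \int[jordan_neg hPN]_x g x| <= delta * V + 2 * eta.
  apply: Hn => //; first exact/(le_trans (negE _ mW))/nV/measurableI.
  apply/(le_trans (negE _ mCW))/neta; first exact: measurableI.
  by apply: WD => x [].
move: Hp Hn; set a := Rintegral _ _ _; set b := Rintegral _ _ _.
set a' := Rintegral _ _ _; set b' := Rintegral _ _ _ => Hp Hn.
have -> : a - a' - (b - b') = (a - b) - (a' - b') by ring.
apply: le_trans (ler_normB _ _) _.
lra.
Qed.

Implicit Type mu : complex_measure T.

Lemma total_variation_bound mu (D : set borel) (v : R) :
  (total_variation mu D < v%:E)%E ->
  forall E, measurable E -> E `<=` D -> normc (cmeas mu E) <= v.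
Proof.
move=> tv E mE ED; rewrite -lee_fin; apply: le_trans (ltW tv).
apply: ereal_sup_ubound; exists 1%N, (fun _ => E); split=> //.
- by move=> i j _ _ _; rewrite (ord1 i) (ord1 j).
- by move=> x [i _] /ED.
- by rewrite big_ord1.
Qed.

Lemma continuous_measurable (phi : trace T -> R[i]) (p : R[i] -> R) :
  continuous (phi : trace T -> R[i]^o) ->
  (forall a b, `|p a - p b| <= normc (a - b)) ->
  measurable_fun setT (fun x : borel => p (phi x)).
Proof.
move=> cphi plip; apply: (measurability _ (RGenOInfty.measurableE R)) => //.
move=> /= _ [_ [r ->] <-]; rewrite setTI; apply: sub_sigma_algebra.
rewrite preimage_itvoy openE => Y /= rY; rewrite /interior.
have d0 : 0 < ((p (phi Y) - r)%:C)%C :> R[i] by rewrite ltcR subr_gt0.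
have /cvgrPdist_lt/(_ _ d0) := cphi Y.
apply: filterS => Z; rewrite normr_normc ltcR => YZ.
rewrite /=; have := le_lt_trans (plip _ _) YZ; have := ler_norm (p (phi Y) - p (phi Z)); lra.
Qed.

Lemma Re_lip (a b : R[i]) : `|complex.Re a - complex.Re b| <= normc (a - b).
Proof. by case: a b => a a' [b b']; exact: (Re_le_normc (Complex (a - b) (a' - b'))). Qed.

Lemma Im_lip (a b : R[i]) : `|complex.Im a - complex.Im b| <= normc (a - b).
Proof. by case: a b => a a' [b b']; exact: (Im_le_normc (Complex (a - b) (a' - b'))). Qed.

(** Both parts of the integral are sums of two charge integrals, so four times
    the bound [2 * (delta * V + 2 * eta)] of [charge_integral_close] occurs. *)
Lemma cintegral_close mu (phi psi : trace T -> R[i]) (D : set borel) (delta V eta : R) :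
  (continuous (phi : trace T -> R[i]^o)) -> (continuous (psi : trace T -> R[i]^o)) ->
  (forall x, normc (phi x) <= 1) -> (forall x, normc (psi x) <= 1) ->
  0 <= delta -> (forall x, ~ D x -> normc (phi x - psi x) <= delta) ->
  (total_variation mu setT < V%:E)%E -> (total_variation mu D < eta%:E)%E ->
  normc (cintegral mu phi - cintegral mu psi) <= 8 * (delta * V + 2 * eta).
Proof.
move=> cphi cpsi phi1 psi1 d0 hD tV teta; rewrite /cintegral.
have mRe phi' := @continuous_measurable phi' (@complex.Re R) ^~ Re_lip.
have mIm phi' := @continuous_measurable phi' (@complex.Im R) ^~ Im_lip.
have Re1 (phi' : trace T -> R[i]) : (forall x, normc (phi' x) <= 1) ->
    forall x, `|complex.Re (phi' x)| <= 1.
  by move=> h x; exact: le_trans (Re_le_normc _) (h x).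
have Im1 (phi' : trace T -> R[i]) : (forall x, normc (phi' x) <= 1) ->
    forall x, `|complex.Im (phi' x)| <= 1.
  by move=> h x; exact: le_trans (Im_le_normc _) (h x).
have ReD x : ~ D x -> `|complex.Re (phi x) - complex.Re (psi x)| <= delta.
  by move=> /hD; apply: le_trans; exact: Re_lip.
have ImD x : ~ D x -> `|complex.Im (phi x) - complex.Im (psi x)| <= delta.
  by move=> /hD; apply: le_trans; exact: Im_lip.
have reV E : measurable E -> E `<=` setT -> `|fine (re_part mu E)| <= V.
  by move=> mE ET; apply: le_trans (total_variation_bound tV mE ET); exact: (Re_le_normc (cmeas mu E)).
have imV E : measurable E -> E `<=` setT -> `|fine (im_part mu E)| <= V.
  by move=> mE ET; apply: le_trans (total_variation_bound tV mE ET); exact: (Im_le_normc (cmeas mu E)).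
have ree E : measurable E -> E `<=` D -> `|fine (re_part mu E)| <= eta.
  by move=> mE ET; apply: le_trans (total_variation_bound teta mE ET); exact: (Re_le_normc (cmeas mu E)).
have ime E : measurable E -> E `<=` D -> `|fine (im_part mu E)| <= eta.
  by move=> mE ET; apply: le_trans (total_variation_bound teta mE ET); exact: (Im_le_normc (cmeas mu E)).
have rr := charge_integral_close (mRe _ cphi) (mRe _ cpsi) (Re1 _ phi1) (Re1 _ psi1) d0 ReD
  (fun E mE => reV E mE (@subsetT _ E)) ree.
have ri := charge_integral_close (mIm _ cphi) (mIm _ cpsi) (Im1 _ phi1) (Im1 _ psi1) d0 ImD
  (fun E mE => reV E mE (@subsetT _ E)) ree.
have ir := charge_integral_close (mRe _ cphi) (mRe _ cpsi) (Re1 _ phi1) (Re1 _ psi1) d0 ReD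
  (fun E mE => imV E mE (@subsetT _ E)) ime.
have ii := charge_integral_close (mIm _ cphi) (mIm _ cpsi) (Im1 _ phi1) (Im1 _ psi1) d0 ImD
  (fun E mE => imV E mE (@subsetT _ E)) ime.
apply: le_trans (normc_le_ReIm _) _ => /=.
move: rr ri ir ii; do 8 move: (charge_integral _ _) => ?.
rewrite !ler_norml; do 4 move=> /andP[? ?].
have h1 (x y : R) : - y <= x -> x <= y -> `|x| <= y by move=> *; rewrite ler_norml; apply/andP.
have -> : 8 * (delta * V + 2 * eta) = 4 * (delta * V + 2 * eta) + 4 * (delta * V + 2 * eta) by lra.
by apply: lerD; apply: h1; lra.
Qed.

End Charges.

(** * Dyadic Urysohn functions, standard and internal *)

Section Urysohn.
Variables (R : realType) (T : Type).
Variables (A : set T) (add : T -> T -> T) (zero : T).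

Definition abgroup : Prop :=
  [/\ forall x y, A x -> A y -> A (add x y), A zero,
      forall x y z, A x -> A y -> A z -> add x (add y z) = add (add x y) z,
      forall x y, A x -> A y -> add x y = add y x &
      forall x, A x -> add zero x = x].

Definition sumset (B C : set T) : set T :=
  [set z | exists x y, [/\ A x, A y, B x, C y & z = add x y]].

(** Only the entries of index at most [N] are constrained, so that an internal
    sequence can satisfy this for one standard [N]. *)
Definition chain (V : nat -> set T) (N : nat) : Prop :=
  (forall n, (n <= N)%N -> V n zero) /\
  forall n, (n < N)%N -> sumset (V n.+1) (V n.+1) `<=` V n.

(** [dyadic V B N m] is the set at height [m / 2^N] of Urysohn's construction:
    [B] at height 0, [B + V 0] at height 1, [A] above 1; at each refinement
    of the scale, [V N] is added at the new heights, which are the odd ones. *)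
Fixpoint dyadic (V : nat -> set T) (B : set T) (N m : nat) : set T :=
  match N with
  | 0 => match m with 0 => A `&` B | 1 => sumset B (V 0%N) | _ => A end
  | N'.+1 => if odd m then sumset (dyadic V B N' m./2) (V N)
             else dyadic V B N' m./2
  end.

Hypothesis AG : abgroup.
Variables (V : nat -> set T) (B : set T).

Lemma dyadic_sub N m : dyadic V B N m `<=` A.
Proof.
have [addA _ _ _ _] := AG.
elim: N m => [[|[|m]]|N IH m] x //=.
- by case.
- by move=> [y [z [Ay Az _ _ ->]]]; exact: addA.
- case: ifP => _; last exact: IH.
  by move=> [y [z [Ay Az _ _ ->]]]; exact: addA.
Qed.

(** Moving along [V n] raises the height by at most [2^-n].  At the finest scale
    this is the definition for even [m], and for odd [m] it is the inclusion of
    [V N + V N] in [V N.-1]; coarser steps are inherited from the coarser scale. *)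
Lemma dyadic_step N : chain V N -> forall n m x s, (n <= N)%N ->
  dyadic V B N m x -> A s -> V n s -> dyadic V B N (m + 2 ^ (N - n)) (add x s).
Proof.
have [addA A0 addAA addCA add0A] := AG.
elim: N => [_|N IH [VN0 VNc]] n m x s.
  rewrite leqn0 => /eqP -> xm As Vs; have Ax := dyadic_sub xm.
  rewrite subnn expn0 addn1 /=; case: m xm => [[_ Bx]|m xm]; last exact: addA.
  by exists x, s.
have cN : chain V N.
  by split=> k kN; [apply: VN0|apply: VNc]; exact: (leq_trans kN).
move=> nN; have [->|nN'] := eqVneq n N.+1.
  rewrite subnn expn0 addn1 => xm As Vs; have Ax := dyadic_sub xm; move: xm => /=.
  have [om|em] /= := boolP (odd m); rewrite uphalf_half ?om ?(negbTE em) /=; last first.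
    by rewrite add0n => xm; exists x, s.
  rewrite add1n => -[y [z [Ay Az ym Vz xE]]]; rewrite xE -addAA //.
  have := IH cN N _ y (add z s) (leqnn N) ym (addA _ _ Az As).
  rewrite subnn expn0 addn1; apply; apply: VNc => //; by exists z, s.
have {nN nN'}nN : (n <= N)%N by rewrite -ltnS ltn_neqAle nN' nN.
rewrite subSn // expnS mul2n => xm As Vs; move: xm => /=.
rewrite oddD odd_double addbF halfD odd_double andbF add0n doubleK.
case: ifP => _; last by move=> xm; exact: IH.
move=> [y [z [Ay Az ym Vz ->]]].
exists (add y s), z; split=> //; [exact: addA|exact: IH|].
by rewrite -!addAA // (addCA z s).
Qed.

Lemma dyadic_mono N : chain V N -> forall m k x, (m <= k)%N ->
  dyadic V B N m x -> dyadic V B N k x.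
Proof.
have [addA A0 addAA addCA add0A] := AG; move=> cN m k x /subnK <-.
elim: (k - m)%N => [|j IH] // /IH xm; have Ax := dyadic_sub xm.
have := dyadic_step cN (leqnn N) xm A0 (cN.1 _ (leqnn N)).
by rewrite subnn expn0 addn1 addSn (addCA x) // add0A.
Qed.

Lemma dyadic0 N : dyadic V B N 0 = A `&` B.
Proof. by elim: N. Qed.

Lemma dyadic_top N : dyadic V B N (2 ^ N) = sumset B (V 0%N).
Proof. by elim: N => //= N <-; rewrite expnS mul2n odd_double doubleK. Qed.

(** The [q] largest indices are lost to the shift. *)
Lemma shifted_sum_le (M q : nat) (a b : nat -> bool) : (q <= M)%N ->
  (forall m, a m -> b (m + q)%N) ->
  (\sum_(0 <= m < M) a m <= q + \sum_(0 <= m < M) b m)%N.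
Proof.
move=> qM ab.
rewrite (big_cat_nat (n := M - q)) ?leq_subr //= addnC.
rewrite [X in (_ <= _ + X)%N](big_cat_nat (n := q)) //= leq_add //.
  apply: (@leq_trans (\sum_(M - q <= m < M) 1)).
    by apply: leq_sum => m _; exact: leq_b1.
  by rewrite sum_nat_const_nat muln1 subKn.
apply: leq_trans (leq_addl _ _); rewrite -{2}[q]add0n big_addn.
by apply: leq_sum => m _; case: (a m) (ab m) => // /(_ isT) ->.
Qed.

(** The last condition bounds the variation on one side; along a subgroup, the
    opposite displacement gives the other side. *)
Definition urysohn_at (W C : set T) (e : R) (u : T -> R) : Prop :=
  [/\ forall x, 0 <= u x <= 1,
      forall x, A x -> B x -> u x = 1,
      forall x, A x ->
        (forall y z, A y -> A z -> B y -> W z -> x <> add y z) -> u x = 0 &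
      forall x s, A x -> A s -> C s -> u x <= u (add x s) + e].

Lemma urysohn N : chain V N -> exists u : T -> R,
  forall n, (n <= N)%N -> urysohn_at (V 0%N) (V n) (2 ^- n) u.
Proof.
move=> cN; have [addA A0 addAA addCA add0A] := AG.
pose r x := (\sum_(0 <= m < 2 ^ N) `[< dyadic V B N m x >])%N.
have M0 : 0 < (2 ^ N)%:R :> R by rewrite ltr0n expn_gt0.
(* the proportion of heights below 1 at which [x] belongs to the dyadic set *)
exists (fun x => (r x)%:R / (2 ^ N)%:R) => n nN; split.
- move=> x; rewrite divr_ge0 //= ler_pdivrMr // mul1r ler_nat /r.
  rewrite -[leqRHS]muln1 -[X in (_ <= X * _)%N]subn0 -sum_nat_const_nat.
  by apply: leq_sum => m _; exact: leq_b1.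
- move=> x Ax Bx; suff -> : r x = (2 ^ N)%N by rewrite divff // lt0r_neq0.
  rewrite -[RHS]muln1 -[X in (X * _)%N]subn0 -sum_nat_const_nat /r.
  apply: eq_big_nat => m _; rewrite asboolT //.
  by apply: (@dyadic_mono _ cN 0) => //; rewrite dyadic0.
- move=> x Ax nx; suff -> : r x = 0%N by rewrite mul0r.
  rewrite /r big_nat big1 // => m /andP[_ mN]; rewrite asboolF // => xm.
  have := dyadic_mono cN (ltnW mN) xm; rewrite dyadic_top => -[y [z [Ay Az By Vz xE]]].
  exact: nx xE.
move=> x s Ax As Vs; rewrite -(ler_pM2r M0) mulrDl !divfK ?lt0r_neq0 //.
have -> : 2 ^- n * (2 ^ N)%:R = (2 ^ (N - n))%:R :> R.
  rewrite -{1}(subnK nN) expnD natrM !natrX mulrC mulfK // ?expf_neq0 // pnatr_eq0.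
rewrite -natrD ler_nat addnC; apply: shifted_sum_le.
  by rewrite leq_exp2l // leq_subr.
by move=> m /asboolP xm; apply/asboolP; exact: dyadic_step.
Qed.
End Urysohn.

Lemma finite_range_bound (Y : Type) (E : nat -> Y) (D : set Y) : finite_set D ->
  D `<=` range E -> exists N, D `<=` E @` [set n | (n <= N)%N].
Proof.
move=> /(@finite_seqP {classic Y})[s ->]; elim: s => [|y s IH] sE.
  by exists 0%N => y.
have [N hN] : exists N, [set` s] `<=` E @` [set n | (n <= N)%N].
  by apply: IH => z zs; apply: sE; rewrite /= inE zs orbT.
have [n _ nE] : range E y by apply: sE; rewrite /= inE eqxx.
exists (maxn n N) => z /=; rewrite inE => /orP[/eqP ->|/hN[k kN <-]].
  by exists n => //=; rewrite leq_maxl.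
by exists k => //=; rewrite leq_max kN orbT.
Qed.

Section Hyper.
Variables (K X : Type) (R : realType) (U : nonstandard_universe K X R).

Lemma admissible_range (Y : Type) (f : nat -> Y) : ~ countable [set: K] ->
  admissible K (range f).
Proof.
move=> ncK; split; last first.
  by move=> Kf; apply: ncK; apply: card_le_trans Kf _; exact: card_image_le.
apply: card_le_trans (card_image_le _ _) _; apply/infiniteP => fK.
by apply: ncK; exact: finite_set_countable.
Qed.

Variables (t : styp) (G : hyperfinite_abelian_group U t).
Local Notation I := (interp X R).
Local Notation tSeq := (tFun tNat (tPow t)).
Local Notation tAdd := (tFun t (tFun t t)).

Definition chains (N : nat) : U (tPow tSeq) :=
  @lift3 _ _ _ U (tPow t) tAdd t (tPow tSeq)
    (fun A add zero => [set V | chain A add zero V N]) (carrier G) (gadd G) (gzero G).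

Definition update (V : U tSeq) (n : nat) (C : U (tPow t)) : U tSeq :=
  @lift3 _ _ _ U tSeq tNat (tPow t) tSeq
    (fun V n C k => if k == n then C else V k) V (icst U (t := tNat) n) C.

Local Notation entry V n := (iapp V (icst U (t := tNat) n%N)).

Lemma update_same V n C : entry (update V n C) n = C.
Proof. by rewrite /update; move: V C; by_transfer => V C; rewrite eqxx. Qed.

Lemma update_other V n C k : k != n -> entry (update V n C) k = (entry V k).
Proof.
by rewrite /update => kn; move: V C; by_transfer => V C; rewrite (negbTE kn).
Qed.

Lemma chains0 V : imem (gzero G) (entry V 0) -> imem V (chains 0).
Proof.
rewrite /chains; move: (carrier G) (gadd G) (gzero G) V.
by_transfer => A add zero V V0; split=> // n; by rewrite leqn0 => /eqP ->.
Qed.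

Lemma chainsS V N C : imem V (chains N) -> imem (gzero G) C ->
  (forall x y, imem x (carrier G) -> imem y (carrier G) -> imem x C -> imem y C ->
     imem (iapp (iapp (gadd G) x) y) (entry V N)) ->
  imem (update V N.+1 C) (chains N.+1).
Proof.
rewrite /chains /update; move: (carrier G) (gadd G) (gzero G) V C.
by_transfer => A add zero V C [V0 Vc] C0 CV; split=> n nN.
  have [//|nN'] := eqVneq n N.+1; apply: V0.
  by rewrite -ltnS ltn_neqAle nN' nN.
rewrite eqSS (ltn_eqF nN); have [->|nN'] := eqVneq n N.
  by move=> _ [x [y [Ax Ay Cx Cy ->]]]; exact: CV.
by apply: Vc; rewrite ltn_neqAle nN' -ltnS.
Qed.

(** An external sequence of internal sets agrees up to any standard index with an
    internal sequence, built by finitely many internal updates. *)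
Lemma chain_internal (V : nat -> U (tPow t)) N :
  (forall n, imem (gzero G) (V n)) ->
  (forall n x y, imem x (carrier G) -> imem y (carrier G) ->
     imem x (V n.+1) -> imem y (V n.+1) -> imem (iapp (iapp (gadd G) x) y) (V n)) ->
  exists2 W : U tSeq, imem W (chains N) & forall n, (n <= N)%N -> entry W n = V n.
Proof.
move=> V0 Vc; elim: N => [|N [W Wc WV]].
  pose W0 : U tSeq := icst U (t := tSeq) (fun _ => set0).
  exists (update W0 0 (V 0%N)); first by apply: chains0; rewrite update_same.
  by move=> n; rewrite leqn0 => /eqP ->; rewrite update_same.
exists (update W N.+1 (V N.+1)).
  by apply: chainsS => // x y *; rewrite WV //; exact: Vc.
move=> n nN; have [->|nN'] := eqVneq n N.+1; first exact: update_same.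
by rewrite update_other // WV // -ltnS ltn_neqAle nN' nN.
Qed.

Definition abgroups : U (tPow t) :=
  @lift2 _ _ _ U (tPow t) tAdd (tPow t)
    (fun A add => [set zero | abgroup A add zero]) (carrier G) (gadd G).

Lemma abgroups_zero : imem (gzero G) abgroups.
Proof.
rewrite /abgroups.
move: (@gadd_closed _ _ _ _ _ G) (gzero_closed G) (@gaddA _ _ _ _ _ G)
  (@gaddC _ _ _ _ _ G) (@gadd0 _ _ _ _ _ G).
move: (carrier G) (gadd G) (gzero G); by_transfer => A add zero h1 h2 h3 h4 h5.
by split=> // x y; exact: h1.
Qed.

Local Notation tFunR := (tFun t tReal).

Definition urysohn_set (B W C : U (tPow t)) (e : R) : U (tPow tFunR) :=
  iapp (iapp (iapp (@lift3 _ _ _ U (tPow t) tAdd (tPow t)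
    (tFun (tPow t) (tFun (tPow t) (tFun tReal (tPow tFunR))))
    (fun A add B W C e => [set u | urysohn_at A add B W C e u])
    (carrier G) (gadd G) B) W) C) (hreal U e).

Definition urysohn_family (B : U (tPow t)) (V : U tSeq) (N : nat) : U (tPow tFunR) :=
  iapp (@lift3 _ _ _ U (tPow t) tAdd (tPow t) (tFun tSeq (tPow tFunR))
    (fun A add B V => [set u | forall n, (n <= N)%N ->
       urysohn_at A add B (V 0%N) (V n) (2 ^- n) u])
    (carrier G) (gadd G) B) V.

Lemma urysohn_family_at B V N n (u : U tFunR) : (n <= N)%N ->
  imem u (urysohn_family B V N) ->
  imem u (urysohn_set B (entry V 0) (entry V n) (2 ^- n)).
Proof.
move=> nN; rewrite /urysohn_family /urysohn_set.
move: (carrier G) (gadd G) B V u; by_transfer => A add B V u; exact.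
Qed.

Lemma urysohn_family_nonempty B V N : imem V (chains N) ->
  exists u : U tFunR, imem u (urysohn_family B V N).
Proof.
move=> Vc; apply: contrapT => nu.
have {nu} : forall u : U tFunR, imem u (urysohn_family B V N) -> False.
  by move=> u hu; apply: nu; exists u.
move: Vc abgroups_zero; rewrite /chains /abgroups /urysohn_family.
move: (carrier G) (gadd G) (gzero G) B V; by_transfer => A add zero B V cV AG.
by have [u hu] := urysohn R AG B cV; move/(_ u hu).
Qed.

(** Finitely many of the conditions [urysohn_set] hold for the transferred
    [urysohn] at the largest index; saturation gives all of them at once.  This
    is where uncountability of [K] is needed. *)
Lemma urysohn_internal (B : U (tPow t)) (V : nat -> U (tPow t)) :
  ~ countable [set: K] ->
  (forall n, imem (gzero G) (V n)) ->
  (forall n x y, imem x (carrier G) -> imem y (carrier G) ->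
     imem x (V n.+1) -> imem y (V n.+1) -> imem (iapp (iapp (gadd G) x) y) (V n)) ->
  exists u : U tFunR, forall n, imem u (urysohn_set B (V 0%N) (V n) (2 ^- n)).
Proof.
move=> ncK V0 Vc; pose E n := urysohn_set B (V 0%N) (V n) (2 ^- n).
have [|D DE finD|u uE] := @saturation _ _ _ U tFunR (range E).
- exact: admissible_range.
- have [N DN] := finite_range_bound finD DE.
  have [W Wc WV] := chain_internal N V0 Vc.
  have [u hu] := urysohn_family_nonempty B Wc.
  exists u => A /DN[n /= nN <-]; have := urysohn_family_at nN hu.
  by rewrite !WV.
- by exists u => n; apply: uE; exists n.
Qed.

Lemma urysohn_set_ge0 B W C e (u : U tFunR) : imem u (urysohn_set B W C e) ->
  forall x, hle (hreal U 0) (iapp u x).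
Proof.
rewrite /urysohn_set; move: (carrier G) (gadd G) B W C u.
by_transfer => A add B W C u [h _ _ _] x; by case/andP: (h x).
Qed.

Lemma urysohn_set_le1 B W C e (u : U tFunR) : imem u (urysohn_set B W C e) ->
  forall x, hle (iapp u x) (hreal U 1).
Proof.
rewrite /urysohn_set; move: (carrier G) (gadd G) B W C u.
by_transfer => A add B W C u [h _ _ _] x; by case/andP: (h x).
Qed.

Lemma urysohn_set_eq1 B W C e (u : U tFunR) : imem u (urysohn_set B W C e) ->
  forall x, imem x (carrier G) -> imem x B -> iapp u x = hreal U 1.
Proof.
rewrite /urysohn_set; move: (carrier G) (gadd G) B W C u.
by_transfer => A add B W C u [_ h _ _] x; exact: h.
Qed.

Lemma urysohn_set_eq0 B W C e (u : U tFunR) : imem u (urysohn_set B W C e) ->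
  forall x, imem x (carrier G) ->
  (forall y z, imem y (carrier G) -> imem z (carrier G) ->
     imem y B -> imem z W -> x <> iapp (iapp (gadd G) y) z) ->
  iapp u x = hreal U 0.
Proof.
rewrite /urysohn_set; move: (carrier G) (gadd G) B W C u.
by_transfer => A add B W C u [_ _ h _] x; exact: h.
Qed.

Definition hadd_cst (a : U tReal) (e : R) : U tReal :=
  @lift2 _ _ _ U tReal tReal tReal (fun a b => a + b) a (hreal U e).

Lemma urysohn_set_step B W C e (u : U tFunR) : imem u (urysohn_set B W C e) ->
  forall x s, imem x (carrier G) -> imem s (carrier G) -> imem s C ->
  hle (iapp u x) (hadd_cst (iapp u (iapp (iapp (gadd G) x) s)) e).
Proof.
rewrite /urysohn_set /hadd_cst; move: (carrier G) (gadd G) B W C u.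
by_transfer => A add B W C u [_ _ _ h] x; exact: h.
Qed.

End Hyper.

(** * Internal sets and the topology of the trace *)

Section Trace.
Variables (K X : Type) (R : realType) (U : nonstandard_universe K X R).
Variables (t : styp) (G : hyperfinite_abelian_group U t) (T : triplet G).
Local Notation I := (interp X R).
Local Notation fnC := (tFun t tCplx).
Local Notation G0 := (G0 T).
Local Notation Gf := (Gf T).
Local Notation extG A := (@ext _ _ _ U _ G A).

Lemma finite_inter_internal (F : set (U (tPow t))) : finite_set F ->
  exists B, forall x, imem x B <->
    imem x (carrier G) /\ forall A, F A -> imem x A.
Proof.
move=> /(@finite_seqP {classic (U (tPow t))})[s ->].
elim: s => [|A s [B BP]].
  by exists (carrier G) => x; split=> // -[].
exists (isetI A B) => x; rewrite imem_setI BP; split.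
  move=> [xA [xG xs]]; split=> // C /=; rewrite inE => /orP[/eqP ->//|Cs].
  exact: xs.
move=> [xG xs]; split; first by apply: xs; rewrite /= inE eqxx.
by split=> // C Cs; apply: xs; rewrite /= inE; apply/orP; right.
Qed.

Lemma ipair_inj (r s : styp) (a a' : U r) (b b' : U s) :
  ipair a b = ipair a' b' -> a = a' /\ b = b'.
Proof.
move=> e; split; move: a a' b b' e; by_transfer => a a' b b'.
  by case.
by case.
Qed.

Definition bad_pairs (D A : U (tPow t)) : U (tPow (tProd t t)) :=
  iapp (@lift3 _ _ _ U (tPow t) (tFun t (tFun t t)) (tPow t)
    (tFun (tPow t) (tPow (tProd t t)))
    (fun C add D A => [set p | [/\ C p.1, C p.2, A p.1, A p.2 & ~ D (add p.1 p.2)]])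
    (carrier G) (gadd G) D) A.

Lemma bad_pairs_intro (D A : U (tPow t)) (x y : gelt G) :
  extG A x -> extG A y -> ~ extG D (x + y) -> imem (ipair (gval x) (gval y)) (bad_pairs D A).
Proof.
rewrite /bad_pairs /ext /=; move: (gval x) (gvalP x) (gval y) (gvalP y).
by move: (carrier G) (gadd G) D A; by_transfer => C add D A u uC v vC; split.
Qed.

Definition hfst (r s : styp) (p : U (tProd r s)) : U r :=
  @lift1 _ _ _ U (tProd r s) r fst p.
Definition hsnd (r s : styp) (p : U (tProd r s)) : U s :=
  @lift1 _ _ _ U (tProd r s) s snd p.

Lemma hpair_eta (r s : styp) (p : U (tProd r s)) : p = ipair (hfst p) (hsnd p).
Proof. by rewrite /hfst /hsnd; move: p; by_transfer => -[]. Qed.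

Lemma bad_pairs_elim (D A : U (tPow t)) (p : U (tProd t t)) :
  imem p (bad_pairs D A) ->
  exists x y : gelt G, [/\ p = ipair (gval x) (gval y), extG A x, extG A y &
    ~ extG D (x + y)].
Proof.
move=> pD.
have [uC [vC [uA [vA uvD]]]] : imem (hfst p) (carrier G) /\ imem (hsnd p) (carrier G) /\
    imem (hfst p) A /\ imem (hsnd p) A /\
    ~ imem (iapp (iapp (gadd G) (hfst p)) (hsnd p)) D.
  move: pD; rewrite /bad_pairs /hfst /hsnd; move: (carrier G) (gadd G) D A p.
  by move=> C add D A p pD; do 4 try split; move: C add D A p pD;
    by_transfer => C add D A p [].
by exists (GElt uC), (GElt vC); split => //; exact: hpair_eta.
Qed.

(** Otherwise every finite intersection of the internal sets defining [G0] would
    contain a pair with sum outside [D]; saturation would then give such a pair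
    inside [G0], which is a subgroup contained in [D]. *)
Lemma halving (D : U (tPow t)) : G0 `<=` extG D ->
  exists V : U (tPow t), G0 `<=` extG V /\
    forall x y : gelt G, extG V x -> extG V y -> extG D (x + y).
Proof.
move=> G0D; have [F0 [aF0 G0E]] := G0_monadic T.
have [[A0 FA0]|F0e] := pselect (F0 !=set0); last first.
  exists (carrier G); split=> [x _|x y _ _]; first exact: gvalP.
  apply: G0D; rewrite G0E => A FA; case: F0e; by exists A.
apply: contrapT => nV.
have [|S SF finS|p pP] := @saturation _ _ _ U _ (bad_pairs D @` F0).
- exact: admissible_image.
- have /choice[q qP] : forall P, exists A, S P -> F0 A /\ bad_pairs D A = P.
    move=> P; have [/SF[A FA <-]|nS] := pselect (S P); first by exists A.
    by exists A0.
  have [B BP] := finite_inter_internal (finite_image q finS).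
  have [x [y [xB yB xyD]]] : exists x y, [/\ extG B x, extG B y & ~ extG D (x + y)].
    apply: contrapT => nxy; apply: nV; exists B; split=> [x|x y xB yB].
      rewrite G0E => xF; apply/BP; split; first exact: gvalP.
      by move=> _ [P /qP[FqP _] <-]; exact: xF.
    by apply: contrapT => xyD; apply: nxy; exists x, y.
  exists (ipair (gval x) (gval y)) => P SP; have [_ <-] := qP P SP.
  by apply: bad_pairs_intro => //; [have /BP[_ /(_ (q P))] := xB|have /BP[_ /(_ (q P))] := yB];
     apply; exists P.
have [x [y [pE _ _ xyD]]] := bad_pairs_elim (pP _ (ex_intro2 _ _ A0 FA0 erefl)).
have mem A : F0 A -> extG A x /\ extG A y.
  move=> FA; have [x' [y' [pE' xA yA _]]] := bad_pairs_elim (pP _ (ex_intro2 _ _ A FA erefl)).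
  move: pE'; rewrite pE => /ipair_inj[/gval_inj -> /gval_inj ->].
  by [].
by apply: xyD; apply: G0D; apply: subgroupD (G0_subgroup T) _ _; rewrite G0E => A /mem[].
Qed.

Lemma halving_chain (D : U (tPow t)) : G0 `<=` extG D ->
  exists V : nat -> U (tPow t), [/\ V 0%N = D, forall n, G0 `<=` extG (V n) &
    forall n (x y : gelt G), extG (V n.+1) x -> extG (V n.+1) y -> extG (V n) (x + y)].
Proof.
move=> G0D.
have /choice[h hP] : forall D, exists V, G0 `<=` extG D -> G0 `<=` extG V /\
    forall x y : gelt G, extG V x -> extG V y -> extG D (x + y).
  move=> E; have [/halving[V ?]|?] := pselect (G0 `<=` extG E); first by exists V.
  by exists E.
have G0V n : G0 `<=` extG (iter n h D).
  by elim: n => //= n IH; have [] := hP _ IH.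
exists (fun n => iter n h D); split=> // n; exact: (hP _ (G0V n)).2.
Qed.

Definition translate (x : gelt G) (A : U (tPow t)) : U (tPow t) :=
  itranslate (gadd G) (gopp G) (gval x) A.

Lemma ext_translate x A (y : gelt G) : extG (translate x A) y <-> extG A (y - x).
Proof. exact: imem_translate. Qed.

Lemma translate_between x (D : U (tPow t)) : Gf x -> G0 `<=` extG D -> extG D `<=` Gf ->
  coset T x `<=` extG (translate x D) /\ extG (translate x D) `<=` Gf.
Proof.
move=> hx G0D DGf; split=> y; first by move=> /G0D ?; apply/ext_translate.
move=> /ext_translate /DGf yx; rewrite -(subrK x y).
exact: subgroupD (Gf_subgroup T) yx hx.
Qed.

(** Halving makes the core of an internal set open: if the coset of [x] lies in
    [E], then so do all cosets meeting [x + V], where [V + V] is inside [E - x]. *)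
Lemma open_core (E : U (tPow t)) : extG E `<=` Gf ->
  open [set Y : trace T | trace_set Y `<=` extG E].
Proof.
move=> EGf; rewrite trace_openE => x hx /= xE.
have [V [G0V VV]] : exists V : U (tPow t), G0 `<=` extG V /\
    forall y z : gelt G, extG V y -> extG V z -> extG (translate (- x) E) (y + z).
  apply: halving => s G0s; apply/ext_translate; rewrite opprK; apply: xE.
  by rewrite /coset /= addrK.
have G00 := (G0_subgroup T).1.
exists (translate x V); split=> y.
  by move=> xy; apply/ext_translate; exact: G0V.
move=> /ext_translate Vyx.
have Ey : extG E y.
  by have /ext_translate := VV _ _ Vyx (G0V _ G00); rewrite addr0 opprK subrK.
exists (EGf _ Ey) => z /= G0zy.
have /ext_translate := VV _ _ (G0V _ G0zy) Vyx.
by rewrite opprK addrA subrK subrK.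
Qed.

(** The cores of internal subsets of [Gf] cover the trace, and a finite union of
    such subsets is again one. *)
Lemma compact_internal (C : set (trace T)) : compact C ->
  exists E : U (tPow t), extG E `<=` Gf /\ forall Y, C Y -> trace_set Y `<=` extG E.
Proof.
rewrite compact_cover => cC.
pose J : choiceType := {classic U (tPow t)}.
have [|Y CY|S SD CS] := cC J [set E | extG E `<=` Gf]
    (fun E => [set Y : trace T | trace_set Y `<=` extG E]).
- by move=> E; exact: open_core.
- have [D [G0D DGf]] := internal_between T.
  have [xD Df] := translate_between (rep_Gf Y) G0D DGf.
  exists (translate (rep Y) D) => //.
  by have := congr1 (@trace_set _ _ _ _ _ _ _) (repK Y) => /= <-.
have [E EP] := finite_union_internal (finite_fset S).
exists E; split.
  by move=> x /EP[A /SD]; rewrite inE => AGf; exact: AGf.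
move=> Y /CS[A AS YA] x /YA xA; apply/EP; by exists A.
Qed.

Variable d : U tReal.
Implicit Types (g f : U fnC).

Definition heavy_sets g (e : R) (B : U (tPow t)) : U (tPow (tPow t)) :=
  iapp (iapp (@lift3 _ _ _ U (tPow t) tReal fnC
    (tFun tReal (tFun (tPow t) (tPow (tPow t))))
    (fun A c h e B => [set Z | [/\ Z `<=` A, Z `&` B = set0 &
       ~ (c * \sum_(x \in (A : set {classic I t}))
         Normc.normc (if `[< Z x >] then h x else 0) < e)]])
    (carrier G) d g) (hreal U e)) B.

Lemma heavy_sets_elim g e B Z : imem Z (heavy_sets g e B) ->
  [/\ internal_subset G Z, forall x, imem x Z -> imem x B -> False &
      ~ hlt (norm1 G d (cutoff g Z)) (hreal U e)].
Proof.
rewrite /heavy_sets /norm1 /cutoff /internal_subset => hZ; split.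
- move: hZ; move: (carrier G) d g B Z; by_transfer => A d' g' B' Z [ZA _ _] x; exact: ZA.
- move: hZ; move: (carrier G) d g B Z; by_transfer => A d' g' B' Z [_ ZB _] x Zx Bx.
  by have : (Z `&` B') x by []; rewrite ZB.
- by move: hZ; move: (carrier G) d g B Z; by_transfer => A d' g' B' Z [_ _].
Qed.

Lemma heavy_sets_intro g e B Z : internal_subset G Z ->
  (forall x, imem x Z -> imem x B -> False) ->
  ~ hlt (norm1 G d (cutoff g Z)) (hreal U e) -> imem Z (heavy_sets g e B).
Proof.
rewrite /heavy_sets /norm1 /cutoff /internal_subset.
move: (carrier G) d g B Z; by_transfer => A d' g' B' Z ZA ZB Zn; split=> //.
by apply/seteqP; split=> // x [/ZB].
Qed.

(** Otherwise no finite union of the internal sets making up [Gf] would do, and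
    saturation would give a single internal set missing all of [Gf] on which [g]
    has norm at least [e]. *)
Lemma Mspace_tight g (e : R) : 0 < e -> Mspace T d g ->
  exists B : U (tPow t), extG B `<=` Gf /\
    hlt (norm1 G d (cutoff g (isetD (carrier G) B))) (hreal U e).
Proof.
move=> e0 [_ gM]; have [Ff [aFf GfE]] := Gf_galactic T.
apply: contrapT => nB.
have [|S SF finS|Z ZP] := @saturation _ _ _ U _ (heavy_sets g e @` Ff).
- exact: admissible_image.
- have /choice[q qP] : forall P, exists A, S P -> Ff A /\ heavy_sets g e A = P.
    move=> P; have [/SF[A FA <-]|nS] := pselect (S P); first by exists A.
    by exists (carrier G).
  have [B BP] := finite_union_internal (finite_image q finS).
  exists (isetD (carrier G) B) => P SP; have [_ <-] := qP P SP.
  apply: heavy_sets_intro.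
  + by move=> x /imem_setD[].
  + by move=> x /imem_setD[_ nxB] xq; apply: nxB; apply/BP; exists (q P) => //; exists P.
  move=> small; apply: nB; exists B; split=> // x /BP[_ [P' /qP[FqP _] <-] xA].
  by rewrite GfE; exists (q P').
have ZB B : Ff B -> _ := fun FB => heavy_sets_elim (ZP _ (ex_intro2 _ _ B FB erefl)).
have := (Gf_subgroup T).1; rewrite GfE => -[B0 FB0 _].
have [ZG _ nZ] := ZB _ FB0.
have ZGf : extG Z `<=` ~` Gf.
  by move=> x Zx; rewrite GfE => -[B FB xB]; have [_ /(_ _ Zx xB)] := ZB _ FB.
apply: nZ; have := gM Z ZG ZGf e e0.
move: (norm1 _ _ _) => n; move: n; by_transfer => n; apply: le_lt_trans.
exact: ler_norm.
Qed.

Definition close_set f (x : U t) (e : R) : U (tPow t) :=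
  @lift3 _ _ _ U fnC t tReal (tPow t)
    (fun h x e => [set y | `| normc (h y - h x) | < e]) f x (hreal U e).

Lemma close_setP f x e y : imem y (close_set f x e) <-> close e (iapp f y) (iapp f x).
Proof. by rewrite /close_set; split; move: f x y; by_transfer. Qed.

Definition S_continuous f : Prop := forall x y : gelt G, Gf x -> Gf y -> G0 (x - y) ->
  approx (iapp f x) (iapp f y).

Lemma flat_fun_approx f (x : gelt G) (hx : Gf x) : le1 G f -> S_continuous f ->
  approx (iapp f x) (hcplx U (flat_fun T f (flat hx))).
Proof.
move=> f1 fS; rewrite /flat_fun.
apply: approx_trans (approx_stpart (finite_bound (f1 _ (gvalP (rep (flat hx)))))).
apply: fS => //; first exact: rep_Gf.
by have := subgroupN (G0_subgroup T) (rep_flat hx); rewrite opprB.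
Qed.

Lemma flat_fun_le1 f Y : le1 G f -> normc (flat_fun T f Y) <= 1.
Proof. by move=> f1; apply: normc_stpart_le; apply: f1; exact: gvalP. Qed.

(** The condition that [f y] be close to [f x] is internal and holds on the coset
    of [x], so it cuts out the internal set required by the topology. *)
Lemma flat_fun_continuous f : le1 G f -> S_continuous f ->
  continuous (flat_fun T f : trace T -> R[i]^o).
Proof.
move=> f1 fS Y; apply/(@cvgrPdist_lt _ _ _ (nbhs Y) (nbhs_filter Y)) => e e0.
have eE : e = ((complex.Re e)%:C)%C by rewrite RRe_real // gtr0_real.
pose O := [set Z : trace T | normc (flat_fun T f Y - flat_fun T f Z) < complex.Re e].
have OY : O Y by rewrite /O /= subrr Normc.normc0 -ltcR -eE.
have oO : open O; last first.
  have : nbhs Y O by apply: open_nbhs_nbhs.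
  apply: (@filterS _ (nbhs Y) (nbhs_filter Y) O) => Z.
  by rewrite /O /= => YZ; rewrite normr_normc eE ltcR.
rewrite trace_openE => x hx; rewrite /O /= => xO.
pose r := complex.Re e - normc (flat_fun T f Y - flat_fun T f (flat hx)).
have r0 : 0 < r by rewrite subr_gt0.
have [D [G0D DGf]] := internal_between T.
have [xD Df] := translate_between hx G0D DGf.
exists (isetI (translate x D) (close_set f (gval x) (r / 2))); split=> y.
  move=> xy; apply/imem_setI; split; first exact: xD.
  apply/close_setP; apply: fS; rewrite ?divr_gt0 //.
  by apply: Df; exact: xD.
move=> /imem_setI[/Df hy /close_setP yx]; exists hy => /=.
have r40 : 0 < r / 4 by rewrite divr_gt0.
have h1 := close_sym (flat_fun_approx hy f1 fS r40).
have h2 := flat_fun_approx hx f1 fS r40.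
have := close_tri (close_tri h1 yx) h2; rewrite close_cst => h3.
have := normcB_tri (flat_fun T f Y) (flat_fun T f (flat hx)) (flat_fun T f (flat hy)).
rewrite (normcB_sym (flat_fun T f (flat hx))).
move: h3; rewrite /r; lra.
Qed.

End Trace.

(** * Characters, and the two uniform continuity statements *)

Section Main.
Variables (K X : Type) (R : realType) (U : nonstandard_universe K X R).
Variables (t : styp) (G : hyperfinite_abelian_group U t) (T : triplet G).
Local Notation I := (interp X R).
Local Notation fnC := (tFun t tCplx).
Local Notation G0 := (G0 T).
Local Notation Gf := (Gf T).
Local Notation extG A := (@ext _ _ _ U _ G A).
Implicit Types (gamma chi : U fnC) (u : U (tFun t tReal)).

Definition circle : U (tPow tCplx) := icst U (t := tPow tCplx) [set z : R[i] | `|z| = 1].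

Lemma circle_le1 z : imem z circle -> hle (hnormc z) (hreal U 1).
Proof.
rewrite /circle; move: z; by_transfer => z /=.
by move=> /normr1_normc ->.
Qed.

Lemma hdual_circle gamma : hdual G gamma ->
  forall x, imem x (carrier G) -> imem (iapp gamma x) circle.
Proof. by move=> [h _ _] x xG; exact: (h (GElt xG)). Qed.

Lemma hdual_le1 gamma : hdual G gamma -> le1 G gamma.
Proof. by move=> hg x xG; apply/circle_le1/hdual_circle. Qed.

Definition far_set gamma chi (e : R) : U (tPow t) :=
  iapp (@lift3 _ _ _ U (tPow t) fnC fnC (tFun tReal (tPow t))
    (fun A h k e => [set x | A x /\ ~ (normc (h x - k x) <= e)])
    (carrier G) gamma chi) (hreal U e).

Lemma far_set_carrier gamma chi e x : imem x (far_set gamma chi e) -> imem x (carrier G).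
Proof.
rewrite /far_set; move: (carrier G) gamma chi x.
by by_transfer => A h k x [].
Qed.

Lemma far_set_far gamma chi e x : imem x (far_set gamma chi e) ->
  ~ hle (hnormc (hsubc (iapp gamma x) (iapp chi x))) (hreal U e).
Proof.
rewrite /far_set; move: (carrier G) gamma chi x.
by by_transfer => A h k x [].
Qed.

Lemma notin_far_set gamma chi e x : imem x (carrier G) -> ~ imem x (far_set gamma chi e) ->
  hle (hnormc (hsubc (iapp gamma x) (iapp chi x))) (hreal U e).
Proof.
move=> xG xZ; apply: contrapT => nle; apply: xZ.
move: x xG nle; rewrite /far_set; move: (carrier G) gamma chi.
by by_transfer => A h k x xA nle; split.
Qed.

Lemma div_close gamma chi e x : hdual G chi -> imem x (carrier G) ->
  close e (iapp (hdual_div gamma chi) x) (hcplx U 1) ->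
  hle (hnormc (hsubc (iapp gamma x) (iapp chi x))) (hreal U e).
Proof.
move=> /hdual_circle h /h; rewrite /circle; move: gamma chi x {h}.
by_transfer => h k x /normr1_normc k1; rewrite ger0_norm ?normc_ge0 // => hk.
apply: ltW; apply: le_lt_trans hk.
have k0 : k x != 0.
  by apply: contra_eq_neq k1 => ->; rewrite Normc.normc0 eq_sym oner_eq0.
have -> : h x - k x = (h x / k x - 1) * k x by rewrite mulrBl divfK // mul1r.
by rewrite Normc.normcM k1 mulr1.
Qed.

(** The choice of scale for [dft_close]. *)
Lemma small_scale (m e : R) : 0 < e -> exists2 e1, 0 < e1 & e1 * m + 2 * e1 <= e.
Proof.
move=> e0; have m0 : 0 < `|m| + 2 by rewrite ltr_wpDl.
exists (e / (`|m| + 2)); first by rewrite divr_gt0.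
have -> : e / (`|m| + 2) * m + 2 * (e / (`|m| + 2)) = e * ((m + 2) / (`|m| + 2)) by ring.
by rewrite ler_piMr ?(ltW e0) // ler_pdivrMr // mul1r lerD2r ler_norm.
Qed.

Section Fixed.
Variables (d : U tReal) (g : U fnC).
Hypothesis d0 : hle (hreal U 0) d.
Hypothesis gM : Mspace T d g.

Lemma norm1_finite : exists m, hle (norm1 G d g) (hreal U m).
Proof.
have [[_ [m gm]] _] := gM; exists m; move: gm; move: (norm1 G d g).
by by_transfer => n; apply: le_trans; exact: ler_norm.
Qed.

Lemma infinitesimal_hlt (n : U tReal) e : infinitesimal_r n -> 0 < e -> hlt n (hreal U e).
Proof.
move=> h e0; have := h e e0; move: n {h}; by_transfer => n; apply: le_lt_trans.
exact: ler_norm.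
Qed.

(** The set where [gamma] and [chi] are more than [e1] apart is internal and
    misses [Gf], so [g] is negligible on it. *)
Lemma dft_Cbu : hdual_Cbu T (dft G d g).
Proof.
split.
  exists (norm1 G d g); split; first exact: gM.1.
  by move=> gamma /hdual_le1; exact: dft_bound.
move=> gamma chi hg hc [_ gc] e e0.
have [m gm] := norm1_finite; have [e1 e10 e1e] := small_scale m e0.
apply: (dft_close (Z := far_set gamma chi e1) d0 (hdual_le1 hg) (hdual_le1 hc) _ gm _ e10 e1e).
  by move=> x; exact: notin_far_set.
apply: (infinitesimal_hlt _ e10); apply: gM.2 => x; first exact: far_set_carrier.
move=> /far_set_far far xGf; apply: far.
exact: div_close hc (gvalP x) (gc x xGf e1 e10).
Qed.

End Fixed.

Lemma conj_continuous (phi : trace T -> R[i]) : continuous (phi : trace T -> R[i]^o) ->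
  continuous ((fun Y => (phi Y)^*) : trace T -> R[i]^o).
Proof.
move=> cphi Y; apply/(@cvgrPdist_lt _ _ _ (nbhs Y) (nbhs_filter Y)) => e e0.
have /(@cvgrPdist_lt _ _ _ (nbhs Y) (nbhs_filter Y))/(_ e e0) := cphi Y.
apply: filterS => Z; by rewrite -rmorphB norm_conjC.
Qed.

Lemma normc_leB (z w : R[i]) (b : R) : normc (z - w) <= b -> normc z <= normc w + b.
Proof. by move=> zw; have := normcD_le (z - w) w; rewrite subrK; lra. Qed.

Section Measure.
Variable mu : complex_measure T.
Hypothesis mureg : regular_measure mu.

Lemma variation_finite : exists V : R, (total_variation mu setT < V%:E)%E.
Proof.
have [+ _] := mureg; case: (total_variation mu setT) => [r| |] // _.
  by exists (r + 1); rewrite lte_fin ltrDl.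
by exists 0; rewrite ltNyr.
Qed.

Lemma regular_compact e : 0 < e -> exists (C : set (trace T)) (D : set (trace T)),
  [/\ compact C, forall Y, ~ D Y -> C Y & (total_variation mu D < e%:E)%E].
Proof.
move=> e0; have [_ reg] := mureg; have [C [W [cC _ _ TW tv]]] := reg setT measurableT e e0.
exists C, (W `\` C); split=> // Y nD; apply: contrapT => nC; apply: nD.
by split=> //; exact: TW.
Qed.

Lemma fourier_stieltjes_Cbu : trace_dual_Cbu (fourier_stieltjes mu).
Proof.
have [V tV] := variation_finite; split.
  exists (normc (cintegral mu (fun=> 0)) + 16 * V) => chi [cchi chi1 _].
  (* comparison with the zero function, the exceptional set being everything *)
  have := @cintegral_close _ _ _ _ _ _ _ mu (fun Y => (chi Y)^*) (fun=> 0) setT 0 V V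
    (conj_continuous cchi) _ _ _ (lexx 0) _ tV tV.
  move=> h; have {}h : normc (cintegral mu (fun Y => (chi Y)^*) - cintegral mu (fun=> 0)) <=
      8 * (0 * V + 2 * V).
    apply: h.
    - exact: cst_continuous.
    - by move=> Y; rewrite normc_conj (normr1_normc _).1.
    - by move=> Y; rewrite Normc.normc0.
    - by move=> Y [].
  apply: le_trans (normc_leB h) _; lra.
move=> e e0.
have eta0 : 0 < e / 64 by rewrite divr_gt0.
have [C [D [cC DC tD]]] := regular_compact eta0.
(* leaves [8 * delta * V < e / 2] and [16 * (e / 64) = e / 4] *)
have [delta delta0 hdelta] := small_scale (V * 16) e0.
exists C, delta; split=> // chi psi [cchi chi1 _] [cpsi psi1 _] close.
apply: (le_lt_trans (@cintegral_close _ _ _ _ _ _ _ mu _ _ D delta V (e / 64)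
  (conj_continuous cchi) (conj_continuous cpsi) _ _ (ltW delta0) _ tV tD)).
- by move=> Y; rewrite normc_conj (normr1_normc _).1.
- by move=> Y; rewrite normc_conj (normr1_normc _).1.
- move=> Y /DC /close h; rewrite -rmorphB normc_conj.
  have psi0 : psi Y != 0 by rewrite -normr_eq0 psi1 oner_eq0.
  have -> : chi Y - psi Y = (chi Y / psi Y - 1) * psi Y by rewrite mulrBl divfK // mul1r.
  by rewrite Normc.normcM ((normr1_normc (psi Y)).1 (psi1 Y)) mulr1 ltW.
lra.
Qed.

End Measure.

Lemma mul_close e (a b : U tCplx) : imem b circle -> close e a (hcplx U 1) ->
  close e (hmulc a b) b.
Proof.
rewrite /circle; move: a b; by_transfer => a b /normr1_normc b1.
have -> : a * b - b = (a - 1) * b by rewrite mulrBl mul1r.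
by rewrite Normc.normcM b1 mulr1.
Qed.

Lemma approx_mul (a b : U tCplx) (x y : R[i]) :
  hle (hnormc a) (hreal U 1) -> normc y <= 1 ->
  approx a (hcplx U x) -> approx b (hcplx U y) -> approx (hmulc a b) (hcplx U (x * y)).
Proof.
move=> a1 y1 ax b_y e e0; have e20 : 0 < e / 2 by rewrite divr_gt0.
have {ax} := ax _ e20; have {b_y} := b_y _ e20; move: a b a1.
by_transfer => a b a1; rewrite !ger0_norm ?normc_ge0 // => b_y ax.
have -> : a * b - x * y = a * (b - y) + (a - x) * y by ring.
apply: le_lt_trans (normcD_le _ _) _; rewrite !Normc.normcM.
have := ler_wpM2r (normc_ge0 (b - y)) a1; have := ler_wpM2l (normc_ge0 (a - x)) y1.
lra.
Qed.

Lemma normc_stpart_circle (z : U tCplx) : imem z circle -> normc (stpart z) = 1.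
Proof.
move=> z1; apply/eqP; rewrite eq_le (normc_stpart_le (circle_le1 z1)) /=.
apply/ler_addgt0Pl => e e0.
have := approx_stpart (finite_bound (circle_le1 z1)) e0; move: (stpart z) => x zx.
rewrite leNgt; apply/negP => xe; move: z1 zx; rewrite /circle; move: z.
by_transfer => z /normr1_normc z1; rewrite ger0_norm ?normc_ge0 // => zx.
have := normcB_tri z x 0; rewrite !subr0; lra.
Qed.

Section Character.
Variable gamma : U fnC.
Hypothesis gG0 : polar G0 gamma.

Lemma character_S_continuous : S_continuous T gamma.
Proof.
have [hg g1] := gG0; move=> x y xf yf xy e e0.
have [_ gD _] := hg; have := gD (x - y) y; rewrite subrK => ->.
apply: mul_close; first exact: (hdual_circle hg (gvalP y)).
exact: g1.
Qed.

Lemma flat_character : trace_dual T (flat_fun T gamma).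
Proof.
have [hg _] := gG0; have gS := character_S_continuous.
have gl := hdual_le1 hg; split.
- exact: flat_fun_continuous.
- move=> Y; apply/normr1_normc; apply: normc_stpart_circle.
  by apply: hdual_circle => //; exact: gvalP.
move=> Y Z; apply: approx_cst_inj.
have hxy := subgroupD (Gf_subgroup T) (rep_Gf Y) (rep_Gf Z).
have -> : Y + Z = flat hxy by rewrite -(flatD (rep_Gf Y) (rep_Gf Z)) !repK.
apply: approx_trans (approx_sym (flat_fun_approx hxy gl gS)) _.
have [_ -> _] := hg.
have aY := flat_fun_approx (rep_Gf Y) gl gS; rewrite repK in aY.
have aZ := flat_fun_approx (rep_Gf Z) gl gS; rewrite repK in aZ.
apply: approx_mul aY aZ; first by apply: gl; exact: gvalP.
exact: flat_fun_le1.
Qed.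

End Character.

End Main.

(** * Truncation of a character *)

Section Cutoff.
Variables (K X : Type) (R : realType) (U : nonstandard_universe K X R).
Variables (t : styp) (G : hyperfinite_abelian_group U t) (T : triplet G).
Local Notation I := (interp X R).
Local Notation fnC := (tFun t tCplx).
Local Notation tFunR := (tFun t tReal).
Local Notation G0 := (G0 T).
Local Notation Gf := (Gf T).
Local Notation extG A := (@ext _ _ _ U _ G A).
Implicit Types (gamma : U fnC) (u : U tFunR).

Definition damp gamma u : U fnC :=
  @lift2 _ _ _ U fnC tFunR fnC (fun h v x => h x * ((v x)%:C)%C) gamma u.

Lemma damp_le1 gamma u : le1 G gamma -> (forall x, hle (hreal U 0) (iapp u x)) ->
  (forall x, hle (iapp u x) (hreal U 1)) -> le1 G (damp gamma u).
Proof.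
rewrite /le1 /damp; move: (carrier G) gamma u; by_transfer => A h v h1 v0 v1 x Ax.
rewrite Normc.normcM normc_real ger0_norm ?v0 //.
by rewrite -[leRHS]mulr1 ler_pM ?normc_ge0 ?v0 ?h1 ?v1.
Qed.

Lemma conjf_le1 gamma : le1 G gamma -> le1 G (conjf gamma).
Proof.
rewrite /le1 /conjf; move: (carrier G) gamma; by_transfer => A h h1 x Ax.
by rewrite normc_conj h1.
Qed.

Lemma damp_eq1 gamma u x : iapp u x = hreal U 1 -> iapp (damp gamma u) x = iapp gamma x.
Proof.
by rewrite /damp; move: gamma u x; by_transfer => h v x ->; rewrite mulr1.
Qed.

Lemma damp_eq0 gamma u x : iapp u x = hreal U 0 ->
  iapp (conjf (damp gamma u)) x = hcplx U 0.
Proof.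
by rewrite /conjf /damp; move: gamma u x; by_transfer => h v x ->; rewrite mulr0 rmorph0.
Qed.

Lemma conjf_close e gamma x y : close e (iapp gamma x) (iapp gamma y) ->
  close e (iapp (conjf gamma) x) (iapp (conjf gamma) y).
Proof.
rewrite /conjf; move: gamma x y; by_transfer => h x y.
by rewrite -rmorphB normc_conj.
Qed.

Lemma conjf_close_cst e gamma x (z : R[i]) : close e (iapp gamma x) (hcplx U z) ->
  close e (iapp (conjf gamma) x) (hcplx U z^*).
Proof.
rewrite /conjf; move: gamma x; by_transfer => h x.
by rewrite -rmorphB normc_conj.
Qed.

Lemma damp_close e r gamma u x y :
  hle (hnormc (iapp gamma x)) (hreal U 1) ->
  hle (hreal U 0) (iapp u y) -> hle (iapp u y) (hreal U 1) ->
  hle (iapp u x) (hadd_cst (iapp u y) r) -> hle (iapp u y) (hadd_cst (iapp u x) r) ->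
  close e (iapp gamma x) (iapp gamma y) ->
  close (e + r) (iapp (damp gamma u) x) (iapp (damp gamma u) y).
Proof.
rewrite /damp /hadd_cst; move: gamma u x y; by_transfer => h v x y h1 v0 v1 xy yx.
rewrite !ger0_norm ?normc_ge0 // => hxy.
have -> : h x * (v x)%:C%C - h y * (v y)%:C%C =
    h x * (v x - v y)%:C%C + (h x - h y) * (v y)%:C%C by rewrite rmorphB /=; ring.
apply: le_lt_trans (normcD_le _ _) _; rewrite !Normc.normcM !normc_real.
rewrite (ger0_norm v0).
have vxy : `|v x - v y| <= r by rewrite ler_norml; apply/andP; split; lra.
have := ler_wpM2r (normr_ge0 (v x - v y)) h1.
have := ler_wpM2l (normc_ge0 (h x - h y)) v1.
lra.
Qed.

Lemma exists_small_pow (e : R) : 0 < e -> exists n, 2 ^- n <= e.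
Proof.
move=> e0; exists (Num.Def.archi_bound e^-1).
rewrite -[leRHS]invrK lef_pV2 ?posrE ?exprn_gt0 ?invr_gt0 //.
apply: ltW; apply: lt_le_trans (archi_boundP _) _; first by rewrite invr_ge0 ltW.
by rewrite -natrX ler_nat ltnW // ltn_expl.
Qed.

(** The Urysohn function of [B] along a chain starting inside [Gf]: its support
    is in [B + V 0], hence in [Gf], and each element of [G0] belongs to all the
    [V n], so that the variation along [G0] is infinitesimal. *)
Lemma cutoff_exists (B : U (tPow t)) : ~ countable [set: K] -> extG B `<=` Gf ->
  exists u, [/\ forall x, hle (hreal U 0) (iapp u x),
    forall x, hle (iapp u x) (hreal U 1),
    forall x : gelt G, extG B x -> iapp u x = hreal U 1,
    forall x : gelt G, ~ Gf x -> iapp u x = hreal U 0 &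
    forall e, 0 < e -> forall x y : gelt G, G0 (x - y) ->
      hle (iapp u x) (hadd_cst (iapp u y) e)].
Proof.
move=> ncK BGf; have [D [G0D DGf]] := internal_between T.
have [V [V0 G0V Vc]] := halving_chain G0D.
have [||u uP] := @urysohn_internal _ _ _ U _ G B V ncK.
- by move=> n; exact: (G0V n _ (G0_subgroup T).1).
- by move=> n x y xG yG Vx Vy; exact: (Vc n (GElt xG) (GElt yG)).
exists u; split.
- exact: urysohn_set_ge0 (uP 0%N).
- exact: urysohn_set_le1 (uP 0%N).
- by move=> x xB; apply: urysohn_set_eq1 (uP 0%N) _ (gvalP x) xB.
- move=> x nx; apply: urysohn_set_eq0 (uP 0%N) _ (gvalP x) _ => y z yG zG yB zV xE.
  apply: nx; have -> : x = GElt yG + GElt zG by exact: gval_inj.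
  apply: subgroupD (Gf_subgroup T) _ _; first exact: BGf.
  by apply: DGf; rewrite -V0.
move=> e e0 x y xy; have [n ne] := exists_small_pow e0.
have G0yx : G0 (y - x) by have := subgroupN (G0_subgroup T) xy; rewrite opprB.
have := urysohn_set_step (uP n) (gvalP x) (gvalP (y - x)) (G0V n _ G0yx).
have -> : iapp (iapp (gadd G) x) (gval (y - x)) = gval y.
  by rewrite -[LHS]/(gval (x + (y - x))) addrC subrK.
rewrite /hadd_cst; move: u {uP} (gval x) (gval y); by_transfer => v a b /le_trans; apply.
by rewrite lerD2l.
Qed.

End Cutoff.

Theorem theorem3p3p3 (K X : Type) (R : realType)
    (U : nonstandard_universe K X R)
    (t : styp) (G : hyperfinite_abelian_group U t) (T : triplet G)
    (d : U tReal) (g : U (tFun t tCplx)) (mu : complex_measure T) :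
  ~ countable [set: K] ->
  condensing T -> normalizing_multiplier T d ->
  regular_measure mu -> Mspace T d g -> weak_lifting d g mu ->
  [/\ hdual_Cbu T (dft G d g),
      trace_dual_Cbu (fourier_stieltjes mu) &
      forall gamma : U (tFun t tCplx), polar (G0 T) gamma ->
        trace_dual T (flat_fun T gamma) /\
        fourier_stieltjes mu (flat_fun T gamma) = stpart (iapp (dft G d g) gamma)].
Proof.
move=> ncK _ [d0 _] mureg gM wl.
have {}d0 : hle (hreal U 0) d by move: d d0 {gM wl}; by_transfer => d; exact: ltW.
split; [exact: dft_Cbu|exact: fourier_stieltjes_Cbu|move=> gamma gG0].
split; first exact: flat_character.
apply/esym/stpart_eq => e e0.
have [hg _] := gG0; have gl := hdual_le1 hg; have gS := character_S_continuous gG0.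
have [cchi chi1 _] := flat_character gG0.
have e30 : 0 < e / 3 by rewrite divr_gt0.
(* [16 * (e / 96) < e / 3] *)
have e960 : 0 < e / 96 by rewrite divr_gt0.
have [V tV] := variation_finite mureg.
have [C [D [cC DC tD]]] := regular_compact mureg e960.
have [E [EGf CE]] := compact_internal cC.
have [m gm] := norm1_finite gM; have [e1 e10 e1e] := small_scale m e30.
have [B [BGf gB]] := Mspace_tight e10 gM.
have [|u [u0 u1 uB uout ustep]] := @cutoff_exists _ _ _ U _ G T (isetU B E) ncK.
  by move=> x /imem_setU[/BGf|/EGf].
(* the truncated character, and the test function *)
pose k := damp gamma u; pose f := conjf k.
have kl : le1 G k by exact: damp_le1.
have fl : le1 G f by exact: conjf_le1.
have fS : S_continuous T f.
  move=> x y xf yf xy r r0; apply: conjf_close; rewrite [r]splitr.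
  have r20 : 0 < r / 2 by rewrite divr_gt0.
  apply: damp_close => //.
  - by apply: gl; exact: gvalP.
  - exact: ustep.
  - apply: ustep => //; have := subgroupN (G0_subgroup T) xy; by rewrite opprB.
  - exact: gS.
have fC0 : C0space T f.
  split=> //.
    exists (hreal U 1); split; last by move=> x; exact: fl.
    by split; [by_transfer|exists 1; by_transfer; rewrite normr1].
  by move=> x nx r r0; rewrite (damp_eq0 _ (uout _ nx)); exact: close_refl.
have [ffin fmu] := wl f fC0; rewrite pairing_conjf in ffin fmu.
have dk : close (e / 3) (iapp (dft G d g) gamma) (iapp (dft G d g) k).
  apply: (dft_close d0 gl kl _ gm gB e10 e1e) => x xG nx.
  have xB : imem x B by apply: contrapT => nB; apply: nx; apply/imem_setD.
  rewrite /k damp_eq1; last by apply: (uB (GElt xG)); apply/imem_setU; left.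
  move: (iapp gamma x) e10 => z e10; move: z; by_transfer => z.
  by rewrite subrr Normc.normc0 ltW.
have kmu : close (e / 3) (iapp (dft G d g) k) (hcplx U (cintegral mu (flat_fun T f))).
  by rewrite fmu; exact: approx_stpart.
have cmu : normc (cintegral mu (flat_fun T f) - fourier_stieltjes mu (flat_fun T gamma)) < e / 3.
  apply: le_lt_trans (cintegral_close (flat_fun_continuous fl fS) (conj_continuous cchi)
    (fun Y => flat_fun_le1 Y fl) _ (lexx 0) _ tV tD) _.
  - by move=> Y; rewrite normc_conj flat_fun_le1.
  - move=> Y /DC CY; suff -> : flat_fun T f Y = (flat_fun T gamma Y)^*.
      by rewrite subrr Normc.normc0.
    apply: stpart_eq => r r0; apply: conjf_close_cst.
    rewrite /k damp_eq1; last first.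
      apply: uB; apply/imem_setU; right; apply: (CE _ CY).
      have := congr1 (@trace_set _ _ _ _ _ _ _) (repK Y) => /= <-.
      by rewrite /coset /= subrr; exact: (G0_subgroup T).1.
    by have := flat_fun_approx (rep_Gf Y) gl gS; rewrite repK; apply.
  lra.
have -> : e = e / 3 + e / 3 + e / 3 by lra.
apply: close_tri (close_tri dk kmu) _; exact/close_cst.
Qed.
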